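(* Let $\delta\in(0,1)$. Suppose that $f$ is in the Barron-type space $\mathcal B([0,1]^d)$ and that $\lambda\ge4M^2\left[2+14d^2\sqrt{2\log(2d)}+\sqrt{2\log(2/(3\delta))}\right]$. Let $$\theta_{S,\lambda}=\arg\min_\theta J_{S,\lambda}(\theta),\qquad J_{S,\lambda}(\theta):=R_S(\theta)+\frac{\lambda}{\sqrt n}\|\theta\|_{\mathcal P}^2\log[\pi(\|\theta\|_{\mathcal P}+1)],$$ be a global minimizer over the parameters $\theta$ of two-layer networks of width $m$. Then with probability at least $1-\delta$ over the choice of i.i.d. uniform random samples $S=\{x_i\}_{i=1}^n$ of $[0,1]^d$, we have $$R_{\mathcal D}(\theta_{S,\lambda}):=\mathbb E_{x\sim\mathcal D}\tfrac12\left(\mathcal L\phi(x;\theta_{S,\lambda})-f(x)\right)^2\le\frac{6M^2\|f\|_{\mathcal B}^2}{m}+\frac{\|f\|_{\mathcal B}^2+1}{\sqrt n}(4\lambda+16M^2)\left\{\log[\pi(2\|f\|_{\mathcal B}+1)]+14d^2\sqrt{\log(2d)}+\sqrt{\log(2/(3\delta))}\right\}.$$ Here square roots of $\log(2/(3\delta))$ and $2\log(2/(3\delta))$ are understood as $0$ when $\log(2/(3\delta))<0$.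
   Context: Let $\Omega=[0,1]^d$ and let $\mathcal D$ be the uniform distribution on $\Omega$. The differential operator is $\mathcal L u=\sum_{\alpha,\beta=1}^d A_{\alpha\beta}(x)u_{x_\alpha x_\beta}+\sum_{\alpha=1}^d b_\alpha(x)u_{x_\alpha}+c(x)u$, where there is a constant $M\ge1$ such that for all $x\in\Omega$, $\alpha,\beta\in\{1,\dots,d\}$: $A_{\alpha\beta}=A_{\beta\alpha}$, $|A_{\alpha\beta}(x)|\le M$, $|b_\alpha(x)|\le M$, $|c(x)|\le M$. Write $A=(A_{\alpha\beta})$, $b=(b_\alpha)$. The right-hand side $f:\Omega\to\mathbb R$ satisfies $|f|\le1$. The activation is $\sigma(z)=\max\{\tfrac16z^3,0\}$, with $\sigma'(z)=\tfrac12(\max\{z,0\})^2$ and $\sigma''(z)=\max\{z,0\}$. The two-layer network of width $m$ is $\phi(x;\theta)=\sum_{k=1}^m a_k\sigma(w_k^{\top}x)$, $\theta=\mathrm{vec}\{a_k,w_k\}_{k=1}^m$ with $a_k\in\mathbb R$, $w_k\in\mathbb R^d$, and $$f_\theta(x):=\mathcal L\phi(x;\theta)=\sum_{k=1}^m a_k\left[w_k^{\top}A(x)w_k\,\sigma''(w_k^{\top}x)+b(x)^{\top}w_k\,\sigma'(w_k^{\top}x)+c(x)\sigma(w_k^{\top}x)\right].$$ Path norm: $\|\theta\|_{\mathcal P}:=\sum_{k=1}^m|a_k|\,\|w_k\|_1^3$. Empirical risk: $R_S(\theta)=\frac1{2n}\sum_{i=1}^n(f_\theta(x_i)-f(x_i))^2$.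 Barron-type functions: for $f:\Omega\to\mathbb R$ let $\mathcal P_f$ be the set of probability distributions $\rho$ on $\mathbb R^{d+1}$ such that for all $x\in\Omega$, $$f(x)=\mathbb E_{(a,w)\sim\rho}\,a\left[w^{\top}A(x)w\,\sigma''(w^{\top}x)+b(x)^{\top}w\,\sigma'(w^{\top}x)+c(x)\sigma(w^{\top}x)\right].$$ The Barron norm is $\|f\|_{\mathcal B}:=\inf_{\rho\in\mathcal P_f}\left(\mathbb E_{(a,w)\sim\rho}|a|^2\|w\|_1^6\right)^{1/2}$, and $\mathcal B(\Omega)=\{f:\Omega\to\mathbb R\mid\|f\|_{\mathcal B}<\infty\}$ (functions having at least one such integral representation and finite norm). *)

(* Defs.v *)
From HB Require Import structures.
From mathcomp Require Import all_boot all_order all_algebra.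
From mathcomp Require Import all_classical all_reals all_analysis.
Import Order.TTheory GRing.Theory Num.Theory.
Import numFieldNormedType.Exports.

Set Implicit Arguments.
Unset Strict Implicit.
Unset Printing Implicit Defensive.

Local Open Scope classical_set_scope.
Local Open Scope ring_scope.

(* [n.-tuple T] carries the product sigma-algebra, but the library has no
   product measure on it: [iid P n] is the law of n independent draws from P,
   see [iid_box]. *)
Section iid.
Context {disp : measure_display} {T : measurableType disp} {R : realType}.

Definition tcons n (x : T * n.-tuple T) : n.+1.-tuple T := [tuple of x.1 :: x.2].

Lemma measurable_tcons n : measurable_fun [set: T * n.-tuple T] (@tcons n).
Proof. exact: measurable_cons. Qed.

HB.instance Definition _ n :=
  isMeasurableFun.Build _ _ _ _ (@tcons n) (@measurable_tcons n).

Fixpoint iid (P : probability T R) (n : nat) : probability (n.-tuple T) R :=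
  if n is n'.+1 then distribution (P \x iid P n')%E (@tcons n')
  else dirac [tuple].

Lemma measurable_box n (A : 'I_n -> set T) : (forall i, measurable (A i)) ->
  measurable [set x : n.-tuple T | forall i, A i (tnth x i)].
Proof.
move=> mA.
rewrite (_ : mkset _ = \bigcap_(i in [set: 'I_n]) ((@tnth n T)^~ i @^-1` A i)).
  apply: fin_bigcap_measurable => // i _; rewrite -[X in measurable X]setTI.
  exact: (measurable_tnth i).
by apply/seteqP; split=> x /= h i; [move=> _; exact: h|exact: (h i I)].
Qed.

Lemma iid_box (P : probability T R) n (A : 'I_n -> set T) :
  (forall i, measurable (A i)) ->
  iid P n [set x | forall i, A i (tnth x i)] = (\prod_(i < n) P (A i))%E.
Proof.
elim: n A => [|n IH] A mA.
  by rewrite big_ord0 /= diracE mem_set// => -[].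
have mB : measurable [set x : n.-tuple T | forall i, A (lift ord0 i) (tnth x i)].
  by apply: (@measurable_box n (A \o lift ord0)) => i; exact: mA.
rewrite big_ord_recl -(IH (fun i => A (lift ord0 i)) (fun i => mA _)).
rewrite -(product_measure1E _ _ (mA ord0) mB).
congr ((P \x iid P n)%E _); apply/seteqP; split=> -[x s] /=.
  move=> h; split; first exact: (h ord0).
  by move=> i; have := h (lift ord0 i); rewrite tnthS.
move=> [h0 h] i; have [j ->|->//] := unliftP ord0 i.
by rewrite tnthS; exact: h.
Qed.

End iid.

Section uniform01.
Context {R : realType}.

(* [uniform_prob] lives on [measurableTypeR R] rather than on R: same carrier
   and same measurable sets, but a different structure. *)
Definition idTR : measurableTypeR R -> R := idfun.

HB.instance Definition _ :=
  @isMeasurableFun.Build _ _ _ _ idTR (@measurable_id _ _ setT).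

Definition uniform01 : probability R R :=
  distribution (uniform_prob (@ltr01 R)) idTR.

End uniform01.

Section setting.
Context {R : realType} {d : nat}.

Definition pt (t : d.-tuple R) : 'rV[R]_d := \row_i tnth t i.

Definition cube : set 'rV[R]_d := [set x | forall i, 0 <= x 0 i <= 1].

(* The uniform distribution on the cube, as a law on the whole space. *)
Definition uniform_cube : probability (d.-tuple R) R :=  iid uniform01 d.

(* w^T x *)
Definition dotr (w x : 'rV[R]_d) : R := \sum_(i < d) w 0 i * x 0 i.

Definition l1norm (w : 'rV[R]_d) : R := \sum_(i < d) `|w 0 i|.

(* sigma, sigma' and sigma'' *)
Definition act (z : R) : R := Num.max (6^-1 * z ^+ 3) 0.
Definition act1 (z : R) : R := 2^-1 * (Num.max z 0) ^+ 2.
Definition act2 (z : R) : R := Num.max z 0.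

Definition partial (i : 'I_d) (u : 'rV[R]_d -> R) : 'rV[R]_d -> R :=
  fun x => 'D_(delta_mx 0 i) u x.

(* Parameters (a, W) of a network of width m, with w_k the k-th row of W. *)
Definition params (m : nat) : Type := ('rV[R]_m * 'M[R]_(m, d))%type.

Definition network m (theta : params m) (x : 'rV[R]_d) : R :=
  \sum_(k < m) theta.1 0 k * act (dotr (row k theta.2) x).

Definition path_norm m (theta : params m) : R :=
  \sum_(k < m) `|theta.1 0 k| * l1norm (row k theta.2) ^+ 3.

Section pde.
Variables (A : 'rV[R]_d -> 'M[R]_d) (b : 'rV[R]_d -> 'rV[R]_d).
Variables (c f : 'rV[R]_d -> R).

Definition diffop (u : 'rV[R]_d -> R) (x : 'rV[R]_d) : R :=
  \sum_(i < d) \sum_(j < d) A x i j * partial j (partial i u) x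
  + \sum_(i < d) b x 0 i * partial i u x + c x * u x.

(* w^T A(x) w sigma''(w^T x) + b(x)^T w sigma'(w^T x) + c(x) sigma(w^T x) *)
Definition feature (w x : 'rV[R]_d) : R :=
  (w *m A x *m w^T) 0 0 * act2 (dotr w x)
  + dotr (b x) w * act1 (dotr w x) + c x * act (dotr w x).

(* rho is the law of (a, w) in an integral representation of f on the cube *)
Definition represents (rho : probability (R * d.-tuple R)%type R) : Prop :=
  forall x, cube x ->
    rho.-integrable setT (fun p => (p.1 * feature (pt p.2) x)%:E) /\
    (f x)%:E = (\int[rho]_p (p.1 * feature (pt p.2) x)%:E)%E.

(* +oo when no law represents f *)
Definition barron_norm : \bar R :=
  ereal_inf [set sqrte (\int[rho]_p (`|p.1| ^+ 2 * l1norm (pt p.2) ^+ 6)%:E)%E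
            | rho in [set rho | represents rho]].

Definition empirical_risk n (S : n.-tuple (d.-tuple R)) m (theta : params m) : R :=
  (2 * n%:R)^-1 *
  \sum_(i < n) (diffop (network theta) (pt (tnth S i)) - f (pt (tnth S i))) ^+ 2.

Definition population_risk m (theta : params m) : \bar R :=
  (\int[uniform_cube]_(t in pt @^-1` cube)
     (2^-1 * (diffop (network theta) (pt t) - f (pt t)) ^+ 2)%:E)%E.

Definition objective (lambda : R) n (S : n.-tuple (d.-tuple R)) m
    (theta : params m) : R :=
  empirical_risk S theta
  + lambda / Num.sqrt n%:R * path_norm theta ^+ 2
    * ln (pi * (path_norm theta + 1)).

Definition is_minimizer (lambda : R) n (S : n.-tuple (d.-tuple R)) m
    (theta : params m) : Prop :=
  forall theta' : params m, objective lambda S theta <= objective lambda S theta'.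

End pde.
End setting.

(* Main.v *)
Require Import Defs.
From mathcomp Require Import all_boot all_order all_algebra.
From mathcomp Require Import all_classical all_reals all_analysis.
From mathcomp Require Import measurable_realfun ring lra.
Import Order.TTheory GRing.Theory Num.Theory.
Import numFieldNormedType.Exports.

Set Implicit Arguments.
Unset Strict Implicit.
Unset Printing Implicit Defensive.

Local Open Scope classical_set_scope.
Local Open Scope ring_scope.

(* Divided by [path_norm theta + 1], the residual of a network is an absolutely convex
   combination of f and of the features of unit directions. So it is bounded by 2 M, and
   its Rademacher average by those of f and of single features, which contraction reduces
   to linear functions on the l1 ball, hence to a maximum over the d coordinates. With
   symmetrization and McDiarmid's inequality, the empirical means of the squared
   normalized residuals fall short of their expectations by at most lambda / sqrt n,
   uniformly over all parameters. Multiplying back by (path_norm + 1)^2 / 2 bounds the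
   generalization gap by a multiple of (path_norm + 1)^2, which the penalty absorbs
   because ln (pi (path_norm + 1)) >= ln 2; no union bound over path norms is needed.
   Comparing the minimizer with a network obtained from the integral representation of f
   by Maurey's argument concludes. *)

(** * Rademacher averages *)

(** The minimizer depends on the sample, so the gap has to be controlled at all parameters at once,
    while a supremum over uncountably many parameters yields no evident event. The event is
    therefore built from rational parameters only, and its inequality is carried to all others by
    passing to the limit. This needs Rademacher bounds that do not grow with the number of
    functions: absolute convexity removes both the width [m] and the size of the class, leaving only
    the [d] coordinates. In the opposite direction only the comparison network matters. It is fixed
    before the sample is drawn, so a single function suffices, and each of the two bad events is
    allotted [delta / 2]. Finally, [f] comes without measurability, and its norm is an infimum that
    need not be attained. Measurability is read off an integral representation; the approximation
    uses a law whose norm is within a factor 21/20 of the infimum, a slack covered by the constant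
    6, and norm zero is treated apart. *)

Section exponential_bounds.
Context {R : realType}.
Implicit Types (x z : R) (f g : R -> R).

Lemma le_of_derive_ge0 f g x : 0 <= x -> (forall y : R, is_derive y (1 : R) f (g y)) ->
  (forall y, 0 <= y -> 0 <= g y) -> f 0 <= f x.
Proof.
rewrite le_eqVlt => /predU1P[<-//|x0] df g0.
have [] := @MVT R f g 0 x x0 (fun y _ => df y).
  apply: derivable_within_continuous => y _; exact: ex_derive.
move=> y; rewrite in_itv/= => /andP[y0 _] fE.
by rewrite -subr_ge0 fE mulr_ge0 ?subr_ge0 ?g0 ?ltW.
Qed.

(** For z >= 0, the product of cosh z and exp (- z^2 / 2) is nonincreasing: up to a positive factor
    its derivative is sinh z - z cosh z. This is nonpositive, as [S] shows by differentiating once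
    more, to z sinh z. Evenness gives the other half-line. *)
Lemma cosh_le_expR z : expR z + expR (- z) <= 2 * expR (z ^+ 2 / 2).
Proof.
wlog z0 : z / 0 <= z.
  move=> H; have [/H//|/ltW z0] := leP 0 z.
  by have := H (- z); rewrite oppr_ge0 z0 opprK sqrrN addrC; apply.
have S x : 0 <= x -> 0 <= x * (expR x + expR (- x)) - (expR x - expR (- x)).
  move=> x0.
  pose f (y : R) := y * (expR y + expR (- y)) - (expR y - expR (- y)).
  have : f 0 <= f x.
    apply: (@le_of_derive_ge0 f (fun y => y * (expR y - expR (- y)))) => // y.
      by apply: is_derive_eq; rewrite /GRing.scale/=; ring.
    by move=> y0; rewrite mulr_ge0// subr_ge0 ler_expR; lra.
  by rewrite /f mul0r oppr0 expR0 !subrr.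
pose f (y : R) := - ((expR y + expR (- y)) * expR (- (y ^+ 2 / 2))).
have : f 0 <= f z.
  apply: (@le_of_derive_ge0 f (fun y => expR (- (y ^+ 2 / 2)) *
    (y * (expR y + expR (- y)) - (expR y - expR (- y))))) => // y.
    by apply: is_derive_eq; rewrite /GRing.scale/=; field.
  by move=> y0; rewrite mulr_ge0 ?expR_ge0// S.
rewrite /f expr0n/= mul0r oppr0 expR0 lerN2 mulr1.
by rewrite [expR (- (_ / _))]expRN ler_pdivrMr ?expR_gt0.
Qed.

Lemma expR_le_chord (c y : R) : 0 < c -> `|y| <= c ->
  expR y <= (expR c + expR (- c)) / 2 + y / c * ((expR c - expR (- c)) / 2).
Proof.
move=> c0; rewrite ler_norml => /andP[cy yc].
(* The weight that writes [y] as a convex combination of [c] and [- c]. *)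
have t01 : 0 <= (1 + y / c) / 2 <= 1.
  have : -1 <= y / c <= 1.
    by rewrite ler_pdivlMr// ler_pdivrMr// mulN1r mul1r cy.
  by move=> /andP[? ?]; apply/andP; split; lra.
have := convex_expR (Itv01 (andP t01).1 (andP t01).2) c (- c).
rewrite !convRE/= /unstable.onem.
have -> : (1 + y / c) / 2 * c + (1 - (1 + y / c) / 2) * - c = y.
  by field; rewrite gt_eqF.
by move=> /le_trans; apply; rewrite le_eqVlt; apply/orP; left; apply/eqP; field; rewrite gt_eqF.
Qed.
End exponential_bounds.

Section signs.
Context {R : realType}.
Implicit Types (G H : seq bool -> R) (n : nat).

(* Expectation over n independent fair signs, encoded as booleans. *)
Fixpoint avg n G : R :=
  if n is n'.+1 then
    (avg n' (fun e => G (true :: e)) + avg n' (fun e => G (false :: e))) / 2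
  else G [::].

(** [avg] supplies sign lists of the exact length; stopping at the shorter list only makes the
    function total. *)
Fixpoint ssum X (e : seq bool) (s : seq X) (h : X -> R) : R :=
  match e, s with
  | b :: e', x :: s' => (if b then h x else - h x) + ssum e' s' h
  | _, _ => 0
  end.

Lemma avg_le n G H : (forall e, G e <= H e) -> avg n G <= avg n H.
Proof.
elim: n G H => [|n IH] G H GH //=.
by rewrite ler_pM2r ?invr_gt0//; apply: lerD; apply: IH.
Qed.

Lemma eq_avg n G H : (forall e, G e = H e) -> avg n G = avg n H.
Proof. by move=> GH; congr avg; apply/funext. Qed.

Lemma avgD n G H : avg n (fun e => G e + H e) = avg n G + avg n H.
Proof. by elim: n G H => [|n IH] G H //=; rewrite !IH; lra. Qed.

Lemma avgZ n c G : avg n (fun e => c * G e) = c * avg n G.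
Proof. by elim: n G => [|n IH] G //=; rewrite !IH; lra. Qed.

Lemma avg_cst n c : avg n (fun=> c) = c.
Proof. by elim: n => [|n IH] //=; rewrite IH; lra. Qed.

Lemma avg_sum n (I : Type) (r : seq I) (F : I -> seq bool -> R) :
  avg n (fun e => \sum_(i <- r) F i e) = \sum_(i <- r) avg n (F i).
Proof.
elim: r => [|i r IH].
  by rewrite big_nil (eq_avg _ (H := fun=> 0)) ?avg_cst// => e; rewrite big_nil.
rewrite big_cons -IH -avgD; apply: eq_avg => e; exact: big_cons.
Qed.

Lemma eq_ssum X e s (h g : X -> R) : h =1 g -> ssum e s h = ssum e s g.
Proof. by move=> hg; congr ssum; apply/funext. Qed.

Lemma ssumD X e s (h g : X -> R) :
  ssum e s (fun x => h x + g x) = ssum e s h + ssum e s g.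
Proof.
by elim: e s => [|b e IH] [|x s] /=; rewrite ?addr0// IH; case: b; ring.
Qed.

Lemma ssumZ X e s c (h : X -> R) : ssum e s (fun x => c * h x) = c * ssum e s h.
Proof.
by elim: e s => [|b e IH] [|x s] /=; rewrite ?mulr0// IH; case: b; ring.
Qed.

Lemma ssumN X e s (h : X -> R) : ssum e s (fun x => - h x) = - ssum e s h.
Proof. by rewrite -mulN1r -ssumZ; apply: eq_ssum => x; rewrite mulN1r. Qed.

Lemma ssum0 X e (s : seq X) : ssum e s (fun=> 0) = 0.
Proof.
by elim: e s => [|b e IH] [|x s] //=; rewrite IH; case: b; rewrite ?oppr0 addr0.
Qed.

Lemma ssum_sum X e s (I : Type) (r : seq I) (F : I -> X -> R) :
  ssum e s (fun x => \sum_(i <- r) F i x) = \sum_(i <- r) ssum e s (F i).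
Proof.
elim: r => [|i r IH].
  by rewrite big_nil (eq_ssum _ _ (g := fun=> 0)) ?ssum0// => x; rewrite big_nil.
rewrite big_cons -IH -ssumD; apply: eq_ssum => x; exact: big_cons.
Qed.

(** Independent signs make the exponential moment a product, and each factor is a cosh, bounded by
    [cosh_le_expR]. *)
Lemma avg_expR_ssum X (s : seq X) (h : X -> R) (K : R) :
  (forall x, List.In x s -> `|h x| <= K) ->
  avg (size s) (fun e => expR (ssum e s h)) <= expR ((size s)%:R * (K ^+ 2 / 2)).
Proof.
elim: s => [|x s IH] hK /=; first by rewrite mul0r expR0.
rewrite (eq_avg _ (H := fun e => expR (h x) * expR (ssum e s h))); last first.
  by move=> e; rewrite expRD.
rewrite [X in (_ + X) / _](eq_avg _
  (H := fun e => expR (- h x) * expR (ssum e s h))); last first.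
  by move=> e; rewrite expRD.
rewrite !avgZ -mulrDl mulrAC -[in leRHS]natr1 [in leRHS]mulrDl mul1r expRD mulrC.
apply: ler_pM; rewrite ?divr_ge0 ?addr_ge0 ?expR_ge0//.
- rewrite -(avg_cst (size s) 0); apply: avg_le => e; exact: expR_ge0.
- by apply: IH => y ys; apply: hK; right.
- rewrite ler_pdivrMr// mulrC; apply: le_trans (cosh_le_expR _) _.
  rewrite ler_pM2l// ler_expR ler_pM2r ?invr_gt0//.
  rewrite -(ger0_norm (sqr_ge0 (h x))) normrX ler_sqr ?nnegrE//.
    by apply: hK; left.
  by apply: le_trans (hK x _); rewrite ?normr_ge0//; left.
Qed.

(* Massart's finite class bound; log-sum-exp is linearized by [1 + z <= expR z]. *)
Lemma avg_finite_class X (s : seq X) (J : finType) (h : J -> X -> R) (K : R)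
    (y : seq bool -> R) :
  0 <= K -> (0 < #|J|)%N ->
  (forall j x, List.In x s -> `|h j x| <= K) ->
  (forall e, exists j, y e <= `|ssum e s (h j)|) ->
  avg (size s) y <= K * Num.sqrt (size s)%:R * Num.sqrt (2 * ln (2 * #|J|%:R)).
Proof.
move=> K0 J0 hK yh.
set n := size s; set p : R := 2 * #|J|%:R.
have p2 : 2 <= p by rewrite /p ler_peMr// ler1n.
have lp : 0 < ln p by rewrite ln_gt0//; lra.
(* The cases [n = 0] and [K = 0] are settled apart, because [mu] below divides by [K] and by the
   square root of [n]. *)
have [n0|n0] := posnP n.
  have [j] := yh [::]; rewrite n0 /=.
  by rewrite /= normr0 => /le_trans; apply; rewrite !mulr_ge0 ?sqrtr_ge0.
have [K0'|Kn0] := eqVneq K 0.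
  rewrite K0' !mul0r -(avg_cst n 0); apply: avg_le => e.
  have [j /le_trans] := yh e; apply.
  suff -> : ssum e s (h j) = 0 by rewrite normr0.
  move: (hK j); rewrite K0'; elim: {n n0 hK yh} s e => [|x s IH] [|b e] //= hj.
  rewrite IH ?addr0; last by move=> z zs; apply: hj; right.
  have := hj x (or_introl erefl); rewrite normr_le0 => /eqP ->.
  by case: b; rewrite ?oppr0.
have Kp : 0 < K by rewrite lt_neqAle eq_sym Kn0.
have nR : (0 : R) < n%:R by rewrite ltr0n.
(* The optimal scale: it makes the two terms of [L] equal. The factor 2 in [p] counts both signs of
   each function, as needed for absolute values. *)
set mu := Num.sqrt (2 * ln p) / (K * Num.sqrt n%:R).
have mu0 : 0 < mu by rewrite divr_gt0 ?mulr_gt0 ?sqrtr_gt0// mulr_gt0.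
set L := ln p + n%:R * ((mu * K) ^+ 2 / 2).
have muK : n%:R * ((mu * K) ^+ 2 / 2) = ln p.
  rewrite /mu; have -> : Num.sqrt (2 * ln p) / (K * Num.sqrt n%:R) * K =
      Num.sqrt (2 * ln p) / Num.sqrt n%:R.
    by field; rewrite ?Kn0 ?gt_eqF ?sqrtr_gt0.
  rewrite expr_div_n !sqr_sqrtr ?ltW// ?mulr_gt0//; field.
  by rewrite gt_eqF.
have step e : y e <= mu^-1 * (L - 1) + mu^-1 * (expR (- L) *
   \sum_j (expR (ssum e s (fun x => mu * h j x)) +
           expR (ssum e s (fun x => - (mu * h j x))))).
  have [j yj] := yh e.
  rewrite -mulrDr ler_pdivlMl//.
  apply: (@le_trans _ _ (mu * `|ssum e s (h j)|)); first by rewrite ler_pM2l.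
  set z := mu * _.
  have : z <= L - 1 + expR (- L) * expR z.
    by rewrite -expRD; have := expR_ge1Dx (- L + z); lra.
  move=> /le_trans; apply; rewrite lerD2l ler_pM2l ?expR_gt0//.
  rewrite (bigD1 j)//= -[leLHS]addr0 lerD//; last first.
    by apply: sumr_ge0 => i _; rewrite addr_ge0 ?expR_ge0.
  rewrite ssumN !ssumZ /z; have [_|_] := ger0P (ssum e s (h j)).
    by rewrite lerDl expR_ge0.
  by rewrite mulrN lerDr expR_ge0.
apply: le_trans (avg_le _ step) _.
rewrite avgD avg_cst !avgZ avg_sum -mulrDr.
have B : \sum_(j <- index_enum J) avg n (fun e => expR (ssum e s (fun x => mu * h j x)) +
           expR (ssum e s (fun x => - (mu * h j x)))) <= expR L.
  have -> : expR L = \sum_(j <- index_enum J) (2 * expR (n%:R * ((mu * K) ^+ 2 / 2))).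
    rewrite big_const_seq/= /L expRD lnK ?posrE; last by lra.
    rewrite iter_addr_0 count_predT -mulr_natr /p.
    have -> : size (index_enum J) = #|J| by rewrite cardT enumT.
    by ring.
  apply: ler_sum => j _; rewrite avgD mulr_natl mulr2n.
  apply: lerD; apply: avg_expR_ssum => x xs; rewrite ?normrN normrM gtr0_norm//;
    by rewrite ler_pM2l// hK.
apply: (@le_trans _ _ (mu^-1 * L)).
  rewrite ler_pM2l ?invr_gt0// -lerBrDl opprB addrC subrK.
  by rewrite expRN mulrC ler_pdivrMr ?expR_gt0// mul1r.
rewrite /L muK /mu invf_div.
have -> : ln p + ln p = Num.sqrt (2 * ln p) ^+ 2 by rewrite sqr_sqrtr; lra.
by rewrite expr2 mulrA divfK// gt_eqF// sqrtr_gt0 mulr_gt0.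
Qed.

End signs.

Section contraction.
Context {R : realType} {T : finType} (t0 : T).
Implicit Types (a b : T -> R).

(** Starting from the value [a t0] avoids any need for a least element of [R]. *)
Definition smax a : R := \big[Num.max/a t0]_t a t.

Lemma le_smax a t : a t <= smax a.
Proof. exact: le_bigmax. Qed.

Lemma smax_le a z : (forall t, a t <= z) -> smax a <= z.
Proof. by move=> az; apply: bigmax_le. Qed.

Lemma smax_attained a : exists t, smax a = a t.
Proof.
rewrite /smax; apply: (big_ind (fun z => exists t, z = a t)).
- by exists t0.
- by move=> _ _ [t ->] [u ->]; case: (leP (a t) (a u)) => _; [exists u|exists t].
- by move=> t _; exists t.
Qed.

Lemma eq_smax a b : a =1 b -> smax a = smax b.
Proof. by move=> ab; congr smax; apply/funext. Qed.

(** Take [t] and [u] attaining the two maxima on the left. Their [p]-difference is at most the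
    absolute [q]-difference, and according to the sign of the latter, [t] and [u] are candidates on
    the right in this order or exchanged. *)
Lemma contraction_step a p q :
  (forall t u, `|p t - p u| <= `|q t - q u|) ->
  smax (fun t => a t + p t) + smax (fun t => a t - p t) <=
  smax (fun t => a t + q t) + smax (fun t => a t - q t).
Proof.
move=> pq.
have [t ->] := smax_attained (fun t => a t + p t).
have [u ->] := smax_attained (fun t => a t - p t).
have := pq t u.
have := le_smax (fun t => a t + q t) t; have := le_smax (fun t => a t + q t) u.
have := le_smax (fun t => a t - q t) t; have := le_smax (fun t => a t - q t) u.
move=> /= H1 H2 H3 H4; rewrite ler_norml => /andP[_].
by case: (ger0P (q t - q u)) => _; lra.
Qed.

(** One sample point is treated at a time. The offset [a] is kept general because it collects the
    terms of the points already passed. *)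
Lemma avg_contraction X (s : seq X) (p q : T -> X -> R) a :
  (forall x, List.In x s -> forall t u, `|p t x - p u x| <= `|q t x - q u x|) ->
  avg (size s) (fun e => smax (fun t => a t + ssum e s (p t))) <=
  avg (size s) (fun e => smax (fun t => a t + ssum e s (q t))).
Proof.
elim: s a => [|x s IH] a pq //=.
have IHs b := IH b (fun y ys => pq y (or_intror ys)).
rewrite ler_pM2r ?invr_gt0//.
have E (c : T -> R) (r : T -> X -> R) :
    avg (size s) (fun e => smax (fun t => a t + (c t + ssum e s (r t)))) =
    avg (size s) (fun e => smax (fun t => (a t + c t) + ssum e s (r t))).
  by apply: eq_avg => e; apply: eq_smax => t; rewrite addrA.
rewrite !E.
apply: (@le_trans _ _ (avg (size s) (fun e => smax (fun t => a t + p t x + ssum e s (q t))) +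
  avg (size s) (fun e => smax (fun t => a t - p t x + ssum e s (q t))))).
  by apply: lerD; exact: IHs.
rewrite -!avgD; apply: avg_le => e.
have F (c : T -> R) : smax (fun t => a t + c t + ssum e s (q t)) =
    smax (fun t => (a t + ssum e s (q t)) + c t).
  by apply: eq_smax => t; rewrite addrAC.
rewrite !F; apply: contraction_step; exact: (pq x (or_introl erefl)).
Qed.

End contraction.

(** * Concentration for i.i.d. samples *)

Section bounded_measurable.
Context {R : realType} {d : measure_display} {T : measurableType d}.
Implicit Types (f g : T -> R) (P : probability T R) (c : R).

(** Bounded and measurable: under a probability such functions are integrable, and the class is
    closed under all the operations used below. *)
Definition bmf f := measurable_fun setT f /\ exists K, forall x, `|f x| <= K.

Lemma bmf_cst (c : R) : bmf (fun=> c).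
Proof. by split; [exact: measurable_cst|exists `|c|]. Qed.

Lemma bmfD f g : bmf f -> bmf g -> bmf (fun x => f x + g x).
Proof.
move=> [mf [K fK]] [mg [L gL]]; split; first exact: measurable_funD.
by exists (K + L) => x; apply: le_trans (ler_normD _ _) _; exact: lerD.
Qed.

Lemma bmfM f g : bmf f -> bmf g -> bmf (fun x => f x * g x).
Proof.
move=> [mf [K fK]] [mg [L gL]]; split; first exact: measurable_funM.
by exists (K * L) => x; rewrite normrM ler_pM.
Qed.

Lemma bmfZ c f : bmf f -> bmf (fun x => c * f x).
Proof. exact/bmfM/bmf_cst. Qed.

Lemma bmfN f : bmf f -> bmf (fun x => - f x).
Proof.
by move=> bf; under eq_fun do rewrite -mulN1r; exact: bmfZ.
Qed.

Lemma bmfB f g : bmf f -> bmf g -> bmf (fun x => f x - g x).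
Proof. by move=> bf /bmfN; exact: bmfD. Qed.

Lemma bmf_expR f : bmf f -> bmf (fun x => expR (f x)).
Proof.
move=> [mf [K fK]]; split; first exact: measurableT_comp.
exists (expR K) => x; rewrite ger0_norm ?expR_ge0// ler_expR.
exact: le_trans (ler_norm _) (fK x).
Qed.

Lemma bmf_max f g : bmf f -> bmf g -> bmf (fun x => Num.max (f x) (g x)).
Proof.
move=> [mf [K fK]] [mg [L gL]]; split; first exact: measurable_maxr.
exists (Num.max K L) => x; rewrite le_max.
by have [_|_] := leP (f x) (g x); rewrite ?fK ?gL ?orbT.
Qed.

Lemma bmf_sum I (r : seq I) (F : I -> T -> R) :
  (forall i, bmf (F i)) -> bmf (fun x => \sum_(i <- r) F i x).
Proof.
move=> bF; elim: r => [|i r IH].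
  by under eq_fun do rewrite big_nil; exact: bmf_cst.
by under eq_fun do rewrite big_cons; exact: bmfD.
Qed.

Lemma bmf_smax (I : finType) (i0 : I) (F : I -> T -> R) :
  (forall i, bmf (F i)) -> bmf (fun x => smax i0 (F ^~ x)).
Proof.
move=> bF; rewrite /smax; elim: index_enum => [|i r IH].
  by under eq_fun do rewrite big_nil.
by under eq_fun do rewrite big_cons; exact: bmf_max.
Qed.

Lemma bmf_avg n (F : seq bool -> T -> R) :
  (forall e, bmf (F e)) -> bmf (fun x => avg n (F ^~ x)).
Proof.
elim: n F => [|n IH] F bF //=.
under eq_fun do rewrite mulrC.
by apply: bmfZ; apply: bmfD; exact: IH.
Qed.

Lemma measurable_bmf_EFin f : bmf f -> measurable_fun setT (fun x => (f x)%:E).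
Proof. by move=> [mf _]; exact/measurable_EFinP. Qed.

Lemma integrable_bmf P f : bmf f -> P.-integrable setT (EFin \o f).
Proof.
move=> [mf [K fK]]; apply: measurable_bounded_integrable => //.
  by apply: le_lt_trans (probability_le1 P measurableT) _; rewrite ltry.
exists K; split; first exact: num_real.
by move=> y Ky x _; exact: le_trans (fK x) (ltW Ky).
Qed.

Lemma Rintegral_le P f g : bmf f -> bmf g -> (forall x, f x <= g x) ->
  \int[P]_x f x <= \int[P]_x g x.
Proof. by move=> bf bg fg; apply: le_Rintegral => //; exact: integrable_bmf. Qed.

Lemma Rintegral_add P f g : bmf f -> bmf g ->
  \int[P]_x (f x + g x) = \int[P]_x f x + \int[P]_x g x.
Proof. by move=> bf bg; apply: RintegralD => //; exact: integrable_bmf. Qed.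

Lemma Rintegral_scale P c f : bmf f -> \int[P]_x (c * f x) = c * \int[P]_x f x.
Proof. by move=> bf; apply: RintegralZl => //; exact: integrable_bmf. Qed.

Lemma Rintegral_const P (c : R) : \int[P]_x c = c.
Proof. by rewrite Rintegral_cst// (congr1 fine (probability_setT P)) mulr1. Qed.

Lemma Rintegral_sub P f g : bmf f -> bmf g ->
  \int[P]_x (f x - g x) = \int[P]_x f x - \int[P]_x g x.
Proof. by move=> bf bg; apply: RintegralB => //; exact: integrable_bmf. Qed.

Lemma EFin_Rintegral P f : bmf f ->
  (\int[P]_x f x)%:E = (\int[P]_x (f x)%:E)%E.
Proof.
move=> bf; rewrite /Rintegral fineK//.
exact/integrable_fin_num/integrable_bmf.
Qed.

Lemma Rintegral_dev P f c : bmf f -> (forall x y, `|f x - f y| <= c) ->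
  forall x, `|f x - \int[P]_y f y| <= c.
Proof.
move=> bf fc x; rewrite -{1}(Rintegral_const P (f x)) -Rintegral_sub//; last exact: bmf_cst.
apply: le_trans (le_normr_Rintegral _ _) _ => //.
  by apply/integrable_bmf/bmfB => //; exact: bmf_cst.
rewrite -[leRHS](Rintegral_const P); apply: Rintegral_le => //; last exact: bmf_cst.
have [m [K fK]] := bmfB (bmf_cst (f x)) bf.
by split; [exact: measurableT_comp|exists K => y; rewrite normr_id].
Qed.

(** In the integrated chord bound the linear term has mean zero; what remains is cosh c, at most exp
    (c^2 / 2). *)
Lemma hoeffding_mgf P f c : bmf f -> 0 < c -> (forall x, `|f x - \int[P]_y f y| <= c) ->
  \int[P]_x expR (f x - \int[P]_y f y) <= expR (c ^+ 2 / 2).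
Proof.
move=> bf c0; set m := \int[P]_y f y => fc.
have bfm : bmf (fun x => f x - m) by apply: bmfB => //; exact: bmf_cst.
pose k := (expR c - expR (- c)) / 2 / c.
apply: (@le_trans _ _ (\int[P]_x ((expR c + expR (- c)) / 2 + k * (f x - m)))).
  apply: Rintegral_le => [||x].
  - exact: bmf_expR.
  - by apply: bmfD; [exact: bmf_cst|exact: bmfZ].
  - apply: le_trans (expR_le_chord c0 (fc x)) _.
    by rewrite lerD2l le_eqVlt; apply/orP; left; apply/eqP; rewrite /k; field; rewrite gt_eqF.
rewrite Rintegral_add; [|exact: bmf_cst|exact: bmfZ].
have /= E := Rintegral_sub P bf (bmf_cst m).
rewrite (Rintegral_scale P k bfm) E.
rewrite !Rintegral_const subrr mulr0 addr0.
by rewrite ler_pdivrMr// mulrC; exact: cosh_le_expR.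
Qed.

End bounded_measurable.

Lemma bmf_comp {R : realType} d d' (T : measurableType d) (T' : measurableType d')
    (g : T' -> T) (f : T -> R) :
  measurable_fun setT g -> bmf f -> bmf (f \o g).
Proof.
move=> mg [mf [K fK]]; split; first exact: measurableT_comp.
by exists K => x /=.
Qed.

Section product_Rintegral.
Context {R : realType} {d1 d2 : measure_display}.
Context {T1 : measurableType d1} {T2 : measurableType d2}.
Variables (P1 : probability T1 R) (P2 : probability T2 R).
Variable f : T1 * T2 -> R.
Hypothesis bf : bmf f.

Lemma bmf_pair2 x : bmf (fun y => f (x, y)).
Proof. exact: bmf_comp (measurable_pair1 x) bf. Qed.

Lemma bmf_Rintegral2 : bmf (fun x => \int[P2]_y f (x, y)).
Proof.
split.
  rewrite (_ : (fun _ => _) = fine \o fubini_F P2 (EFin \o f))//.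
  apply: measurableT_comp => //; apply: measurable_fubini_F.
  exact: (integrable_bmf (P1 \x P2)%E bf).
have [_ [K fK]] := bf; exists K => x.
apply: le_trans (le_normr_Rintegral _ _) _ => //.
  exact/integrable_bmf/bmf_pair2.
rewrite -[leRHS](Rintegral_const P2).
apply: le_Rintegral => //; try apply: integrable_bmf; last exact: bmf_cst.
have [m _] := bmf_pair2 x.
by split; [exact: measurableT_comp|exists K => y; rewrite normr_id].
Qed.

Lemma Rintegral_prod :
  \int[P1]_x \int[P2]_y f (x, y) = \int[(P1 \x P2)%E]_z f z.
Proof.
apply: EFin_inj; rewrite (EFin_Rintegral P1) ?(EFin_Rintegral (P1 \x P2)%E)//;
  last exact: bmf_Rintegral2.
have := integral12_prod_meas1 (integrable_bmf (P1 \x P2)%E bf); rewrite /fubini_F /= => <-.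
by apply: eq_integral => x _; rewrite EFin_Rintegral//; exact: bmf_pair2.
Qed.

End product_Rintegral.

Section iid_concentration.
Context {R : realType} {d : measure_display} {T : measurableType d}.
Variable P : probability T R.

Lemma bmf_tcons n (Z : n.+1.-tuple T -> R) : bmf Z -> bmf (fun z => Z (tcons z)).
Proof. exact: bmf_comp (@measurable_tcons _ _ n). Qed.

Lemma Rintegral_iid0 (Z : 0.-tuple T -> R) : bmf Z ->
  \int[iid P 0]_s Z s = Z [tuple].
Proof.
move=> bZ; rewrite /Rintegral /= integral_dirac//; first by rewrite diracT mul1e.
exact: measurable_bmf_EFin.
Qed.

Lemma Rintegral_iidS n (Z : n.+1.-tuple T -> R) : bmf Z ->
  \int[iid P n.+1]_s Z s = \int[P]_x \int[iid P n]_s Z (tcons (x, s)).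
Proof.
move=> bZ; have bZc := bmf_tcons bZ.
rewrite (Rintegral_prod P (iid P n) bZc); congr fine.
apply: integral_distribution.
  exact: measurable_bmf_EFin.
exact: (integrable_bmf (P \x iid P n)%E bZc).
Qed.

(** Bounded differences stated along the recursion of [iid]: vary the head with the tail fixed, then
    recurse on the tail with the head fixed. *)
Fixpoint bdiff (c : R) n : (n.-tuple T -> R) -> Prop :=
  if n is n'.+1 then fun Z =>
    (forall x y s, `|Z (tcons (x, s)) - Z (tcons (y, s))| <= c) /\
    (forall x, bdiff c (fun s : n'.-tuple T => Z (tcons (x, s))))
  else fun=> True.

(** The martingale argument as an induction. [g x] is the conditional mean given the head. The
    fluctuation around it is bounded by the induction hypothesis, uniformly in [x]; [g] itself
    varies by at most [c] and falls under [hoeffding_mgf]. *)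
Lemma mcdiarmid_mgf c t n (Z : n.-tuple T -> R) :
  0 < c -> 0 < t -> bmf Z -> bdiff c Z ->
  \int[iid P n]_s expR (t * (Z s - \int[iid P n]_u Z u)) <=
  expR (n%:R * ((t * c) ^+ 2 / 2)).
Proof.
move=> c0 t0; elim: n Z => [|n IH] Z bZ dZ.
  rewrite mul0r expR0 (Rintegral_iid0 bZ) (@Rintegral_iid0 (fun s => expR (t * (Z s - Z [tuple])))).
    by rewrite subrr mulr0 expR0.
  by apply/bmf_expR/bmfZ/bmfB => //; exact: bmf_cst.
have [dx ds] := dZ.
have bZc := bmf_tcons bZ.
have bZx x : bmf (fun s => Z (tcons (x, s))) by exact: bmf_pair2 bZc x.
set m := \int[iid P n.+1]_u Z u.
have bE : bmf (fun s => expR (t * (Z s - m))).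
  by apply/bmf_expR/bmfZ/bmfB => //; exact: bmf_cst.
rewrite (Rintegral_iidS bE).
pose g x := \int[iid P n]_s Z (tcons (x, s)).
have bg : bmf g := bmf_Rintegral2 P (iid P n) bZc.
have mE : m = \int[P]_x g x by rewrite /m (Rintegral_iidS bZ).
have gd x y : `|g x - g y| <= c.
  rewrite /g -Rintegral_sub//.
  apply: le_trans (le_normr_Rintegral _ _) _ => //.
    by apply/integrable_bmf/bmfB.
  rewrite -[leRHS](Rintegral_const (iid P n)); apply: Rintegral_le => //; last exact: bmf_cst.
  have [mm [K fK]] := bmfB (bZx x) (bZx y).
  by split; [exact: measurableT_comp|exists K => s; rewrite normr_id].
have btg : bmf (fun x => t * g x) by exact: bmfZ.
have tgm : \int[P]_x (t * g x) = t * m by rewrite (Rintegral_scale P t bg) mE.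
have := @hoeffding_mgf _ _ _ P (fun x => t * g x) (t * c) btg (mulr_gt0 t0 c0).
rewrite tgm => H.
have {}H : \int[P]_x expR (t * g x - t * m) <= expR ((t * c) ^+ 2 / 2).
  apply: H => x; rewrite -mulrBr normrM gtr0_norm// ler_pM2l// mE.
  exact: Rintegral_dev.
apply: (@le_trans _ _ (\int[P]_x (expR (n%:R * ((t * c) ^+ 2 / 2)) * expR (t * g x - t * m)))).
  apply: Rintegral_le => [||x].
  - exact: (bmf_Rintegral2 P (iid P n) (bmf_tcons bE)).
  - by apply/bmfZ/bmf_expR/bmfB => //; exact: bmf_cst.
  - rewrite mulrC.
    have bW : bmf (fun s => expR (t * (Z (tcons (x, s)) - g x))).
      by apply/bmf_expR/bmfZ/bmfB => //; exact: bmf_cst.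
    have := ler_wpM2l (expR_ge0 (t * g x - t * m)) (IH _ (bZx x) (ds x)).
    rewrite -/(g x) -(Rintegral_scale (iid P n) _ bW); apply: le_trans.
    rewrite le_eqVlt; apply/orP; left; apply/eqP; apply: eq_Rintegral => s _.
    by rewrite -expRD; congr expR; ring.
rewrite (Rintegral_scale P _ (bmf_expR (bmfB btg (bmf_cst (t * m))))).
rewrite -[in leRHS]natr1 [in leRHS]mulrDl mul1r expRD ler_pM2l ?expR_gt0//.
Qed.

Lemma mcdiarmid c delta n (Z : n.-tuple T -> R) :
  (0 < n)%N -> 0 < c -> 0 < delta < 1 -> bmf Z -> bdiff c Z ->
  (iid P n [set s | (\int[iid P n]_u Z u)%R +
     c * Num.sqrt n%:R * Num.sqrt (2 * ln delta^-1) <= Z s]%R <= delta%:E)%E.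
Proof.
move=> n0 c0 /andP[d0 d1] bZ dZ.
set L := ln delta^-1; set m := (\int[iid P n]_u Z u)%R.
have L0 : 0 < L by rewrite /L ln_gt0// invf_gt1.
have nR : (0 : R) < n%:R by rewrite ltr0n.
set tau := c * _ * _.
have tau0 : 0 < tau by rewrite /tau !mulr_gt0// sqrtr_gt0// mulr_gt0.
have tau2 : tau ^+ 2 = c ^+ 2 * n%:R * (2 * L).
  by rewrite /tau !exprMn !sqr_sqrtr ?ltW// mulr_gt0.
(* The minimizer of the Chernoff exponent - t tau + n (t c)^2 / 2, whose value there is - tau^2 / (2
   n c^2) = ln delta. *)
pose t := tau / (n%:R * c ^+ 2).
have t0 : 0 < t by rewrite divr_gt0// mulr_gt0// exprn_gt0.
have bW : bmf (fun s => expR (t * (Z s - m))).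
  by apply/bmf_expR/bmfZ/bmfB => //; exact: bmf_cst.
have mA : measurable [set s | (m + tau <= Z s)%R].
  rewrite (_ : [set s | _] = setT `&` Z @^-1` `[m + tau, +oo[%classic).
    by have [mZ _] := bZ; exact: mZ.
  by rewrite setTI; apply/seteqP; split => s /=; rewrite in_itv/= andbT.
rewrite -[X in iid P n X]setIT -(integral_indic _ measurableT mA).
apply: (@le_trans _ _ (\int[iid P n]_s (expR (- (t * tau)) * expR (t * (Z s - m)))%:E)%E).
  apply: ge0_le_integral => //=.
  - exact/measurable_EFinP/measurable_indic.
  - exact/measurable_bmf_EFin/bmfZ.
  - move=> s _; rewrite lee_fin -expRD indicE; case: (boolP (_ \in _)) => [|_].
      rewrite inE /= => mt; rewrite -[leLHS]expR0 ler_expR.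
      by rewrite -mulrN -mulrDr mulr_ge0 ?(ltW t0)//; lra.
    exact: expR_ge0.
rewrite -(EFin_Rintegral (iid P n) (bmfZ _ bW)) lee_fin.
rewrite (Rintegral_scale _ _ bW).
apply: (@le_trans _ _ (expR (- (t * tau)) * expR (n%:R * ((t * c) ^+ 2 / 2)))).
  by rewrite ler_pM2l ?expR_gt0//; exact: mcdiarmid_mgf.
rewrite -expRD -[leRHS]lnK ?posrE// ler_expR.
have -> : ln delta = - L by rewrite /L lnV ?posrE// opprK.
have c0' : c != 0 by rewrite gt_eqF.
have n0' : (n%:R : R) != 0 by rewrite gt_eqF.
have -> : n%:R * ((t * c) ^+ 2 / 2) = tau ^+ 2 / (c ^+ 2 * n%:R) / 2.
  by rewrite /t; field; rewrite c0' n0'.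
have -> : t * tau = tau ^+ 2 / (c ^+ 2 * n%:R).
  by rewrite /t; field; rewrite c0' n0'.
have -> : tau ^+ 2 / (c ^+ 2 * n%:R) = 2 * L.
  by rewrite tau2; field; rewrite c0' n0'.
by lra.
Qed.

End iid_concentration.

Section tuples.
Context {R : realType} {d : measure_display} {T : measurableType d}.
Implicit Types (h : T -> R).

Lemma bmf_tuple_sum n h : bmf h -> bmf (fun s : n.-tuple T => \sum_(x <- s) h x).
Proof.
move=> bh; under eq_fun do rewrite big_tuple.
by apply: bmf_sum => j; exact: bmf_comp (measurable_tnth j) bh.
Qed.

(** For fixed signs this is a linear combination of functions of single coordinates, from which
    measurability in the sample follows. The test on [size e] accounts for sign lists that are too
    short. *)
Lemma ssum_tuple n (e : seq bool) (s : n.-tuple T) h :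
  ssum e s h =
  \sum_(j < n) (if (j < size e)%N then (-1) ^+ ~~ nth true e j else 0) * h (tnth s j).
Proof.
elim: n e s => [|n IH] e; first by move=> s; rewrite tuple0 big_ord0; case: e.
case/tupleP => x s; case: e => [|b e]; first by rewrite big1// => i _; rewrite mul0r.
rewrite big_ord_recl /= IH; congr (_ + _).
  by rewrite tnth0; case: b; rewrite ?mul1r ?mulN1r.
by apply: eq_bigr => i _; rewrite tnthS.
Qed.

Lemma bmf_ssum n e h : bmf h -> bmf (fun s : n.-tuple T => ssum e s h).
Proof.
move=> bh; under eq_fun do rewrite ssum_tuple.
by apply: bmf_sum => j; apply/bmfZ; exact: bmf_comp (measurable_tnth j) bh.
Qed.

End tuples.

Lemma smax_lip {R : realType} (I : finType) (i0 : I) (a b : I -> R) c :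
  (forall i, `|a i - b i| <= c) -> `|smax i0 a - smax i0 b| <= c.
Proof.
move=> ab; have [i ai] := smax_attained i0 a; have [j bj] := smax_attained i0 b.
have := le_smax i0 a j; have := le_smax i0 b i.
have := ab i; have := ab j; rewrite ai bj !ler_norml => /andP[? ?] /andP[? ?] ? ?.
by apply/andP; split; lra.
Qed.

Section symmetrization.
Context {R : realType} {d : measure_display} {T : measurableType d}.
Variable P : probability T R.

Lemma Rintegral_swap d' (U : measurableType d') (Q : probability U R)
    (f : T * U -> R) : bmf f ->
  \int[P]_x \int[Q]_y f (x, y) = \int[Q]_y \int[P]_x f (x, y).
Proof.
move=> bf; rewrite (Rintegral_prod P Q bf).
have bg : bmf (fun z : U * T => f (z.2, z.1)).
  exact: (bmf_comp (g := fun z => (z.2, z.1)) (measurable_fun_pair measurable_snd measurable_fst)).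
have bG := bmf_Rintegral2 Q P bg.
apply: EFin_inj; rewrite (EFin_Rintegral Q bG) (EFin_Rintegral (P \x Q)%E bf).
have := integral21_prod_meas1 (integrable_bmf (P \x Q)%E bf).
rewrite /fubini_G /= => <-.
by apply: eq_integral => y _; rewrite EFin_Rintegral//; exact: (bmf_pair2 bg y).
Qed.

Variables (I : finType) (i0 : I) (h : I -> T -> R).
Hypothesis bh : forall i, bmf (h i).

Let m i := \int[P]_x h i x.

(* Writing [a + (h - m)] as the mean of [a + 2 h] and [a - 2 m], only the second term
   needs Jensen's inequality, so no ghost sample is involved. *)
Lemma symmetrization_step a :
  \int[P]_x smax i0 (fun i => a i + (h i x - m i)) <=
  \int[P]_x (2^-1 * (smax i0 (fun i => a i + 2 * h i x) +
                     smax i0 (fun i => a i - 2 * h i x))).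
Proof.
have b1 : bmf (fun x => smax i0 (fun i => a i + 2 * h i x)).
  by apply: bmf_smax => i; apply: bmfD; [exact: bmf_cst|exact: bmfZ].
have b2 : bmf (fun x => smax i0 (fun i => a i - 2 * h i x)).
  by apply: bmf_smax => i; apply: bmfB; [exact: bmf_cst|exact: bmfZ].
set v := \int[P]_x smax i0 (fun i => a i - 2 * h i x).
apply: (@le_trans _ _ (\int[P]_x (2^-1 * (smax i0 (fun i => a i + 2 * h i x) + v)))).
  apply: Rintegral_le => [||x].
  - by apply: bmf_smax => i; apply: bmfD; [exact: bmf_cst|apply: bmfB => //; exact: bmf_cst].
  - by apply: bmfZ; apply: bmfD => //; exact: bmf_cst.
  - apply: smax_le => i.
    have vi : a i - 2 * m i <= v.
      rewrite /v -[a i](Rintegral_const P) -(Rintegral_scale P 2 (bh i)).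
      have b3 : bmf (fun _ : T => a i) by exact: bmf_cst.
      rewrite -(Rintegral_sub P b3 (bmfZ 2 (bh i))).
      apply: Rintegral_le => [||y]; [by apply: bmfB => //; exact: bmfZ|by []|].
      exact: (le_smax i0 (fun i => a i - 2 * h i y) i).
    have := le_smax i0 (fun i => a i + 2 * h i x) i => /=.
    by lra.
rewrite !Rintegral_scale//; [|exact: bmfD|by apply: bmfD => //; exact: bmf_cst].
by rewrite !Rintegral_add ?Rintegral_const//; exact: bmf_cst.
Qed.

(** Induction on the sample. The head is symmetrized with the centred sum over the tail as fixed
    part; then the two signed head terms join the offset and the induction hypothesis handles the
    tail. *)
Lemma symmetrization n a :
  \int[iid P n]_s smax i0 (fun i => a i + \sum_(x <- s) (h i x - m i)) <=
  \int[iid P n]_s avg n (fun e => smax i0 (fun i => a i + 2 * ssum e s (h i))).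
Proof.
have bm i : bmf (fun x => h i x - m i) by apply: bmfB => //; exact: bmf_cst.
have bU k b : bmf (fun s : k.-tuple T => smax i0 (fun i => b i + \sum_(x <- s) (h i x - m i))).
  by apply: bmf_smax => i; apply: bmfD; [exact: bmf_cst|exact: bmf_tuple_sum].
have bV k l b : bmf (fun s : k.-tuple T =>
    avg l (fun e => smax i0 (fun i => b i + 2 * ssum e s (h i)))).
  apply: bmf_avg => e; apply: bmf_smax => i; apply: bmfD; first exact: bmf_cst.
  exact/bmfZ/bmf_ssum.
elim: n a => [|n IH] a.
  rewrite (Rintegral_iid0 _ (bU 0 a)) (Rintegral_iid0 _ (bV 0 0 a)) /=.
  by rewrite le_eqVlt; apply/orP; left; apply/eqP; apply: eq_smax => i; rewrite big_nil mulr0.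
rewrite (Rintegral_iidS _ (bU n.+1 a)) (Rintegral_iidS _ (bV n.+1 n.+1 a)).
pose F (z : T * n.-tuple T) := smax i0 (fun i =>
  (a i + \sum_(x <- z.2) (h i x - m i)) + (h i z.1 - m i)).
pose G (z : T * n.-tuple T) := 2^-1 * (smax i0 (fun i =>
  (a i + \sum_(x <- z.2) (h i x - m i)) + 2 * h i z.1) +
  smax i0 (fun i =>
  (a i + \sum_(x <- z.2) (h i x - m i)) - 2 * h i z.1)).
have b1 i : bmf (fun z : T * n.-tuple T => a i + \sum_(x <- z.2) (h i x - m i)).
  apply: bmfD; first exact: bmf_cst.
  exact: (bmf_comp measurable_snd (bmf_tuple_sum n (bm i))).
have b2 i : bmf (fun z : T * n.-tuple T => h i z.1) by exact: (bmf_comp measurable_fst (bh i)).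
have bF : bmf F.
  by apply: bmf_smax => i; apply: bmfD => //; apply: bmfB => //; exact: bmf_cst.
have bG : bmf G.
  apply: bmfZ; apply: bmfD; apply: bmf_smax => i; first by apply: bmfD => //; exact: bmfZ.
  by apply: bmfB => //; exact: bmfZ.
rewrite (_ : Rintegral _ _ _ = \int[P]_x \int[iid P n]_s F (x, s)); last first.
  apply: eq_Rintegral => x _; apply: eq_Rintegral => s _; apply: eq_smax => i.
  by rewrite big_cons /=; ring.
(* The head has to be the inner variable for [symmetrization_step]; the order is restored afterwards
   for the induction hypothesis. *)
rewrite (Rintegral_swap (iid P n) bF).
apply: (@le_trans _ _ (\int[iid P n]_s \int[P]_x G (x, s))).
  apply: Rintegral_le => [||s]; last exact: (symmetrization_step (fun i => a i +
    \sum_(x <- s) (h i x - m i))).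
  - exact: (bmf_Rintegral2 (iid P n) P (bmf_comp (g := fun z => (z.2, z.1))
      (measurable_fun_pair measurable_snd measurable_fst) bF)).
  - exact: (bmf_Rintegral2 (iid P n) P (bmf_comp (g := fun z => (z.2, z.1))
      (measurable_fun_pair measurable_snd measurable_fst) bG)).
rewrite -(Rintegral_swap (iid P n) bG).
apply: Rintegral_le => [||x].
- exact: (bmf_Rintegral2 P (iid P n) bG).
- exact: (bmf_Rintegral2 P (iid P n) (bmf_tcons (bV n.+1 n.+1 a))).
pose ap i := a i + 2 * h i x; pose am i := a i - 2 * h i x.
have GE s : G (x, s) = 2^-1 * (smax i0 (fun i => ap i + \sum_(x <- s) (h i x - m i)) +
                               smax i0 (fun i => am i + \sum_(x <- s) (h i x - m i))).
  by rewrite /G; congr (_ * (_ + _)); apply: eq_smax => i; rewrite /ap /am addrAC.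
rewrite (eq_Rintegral _ (g := fun s : n.-tuple T => 2^-1 * (smax i0 (fun i => ap i +
  \sum_(x <- s) (h i x - m i)) +
                               smax i0 (fun i => am i + \sum_(x <- s) (h i x - m i)))));
                               last by move=> s _; exact: GE.
rewrite (Rintegral_scale _ _ (bmfD (bU n ap) (bU n am))) (Rintegral_add _ (bU n ap) (bU n am)).
set rhs := (X in _ <= X).
have -> : rhs = \int[iid P n]_s (2^-1 *
    (avg n (fun e => smax i0 (fun i => ap i + 2 * ssum e s (h i))) +
     avg n (fun e => smax i0 (fun i => am i + 2 * ssum e s (h i))))).
  apply: eq_Rintegral => s _ /=; rewrite [LHS]mulrC.
  congr (_ * (_ + _)); apply: eq_avg => e; apply: eq_smax => i.
    by rewrite mulrDr addrA.
  by rewrite mulrDr addrA mulrN.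
rewrite (Rintegral_scale _ _ (bmfD (bV n n ap) (bV n n am))) (Rintegral_add _ (bV n n ap)
  (bV n n am)).
by rewrite ler_pM2l ?invr_gt0//; apply: lerD; exact: IH.
Qed.

End symmetrization.

Section uniform_deviation.
Context {R : realType} {d : measure_display} {T : measurableType d}.
Variables (P : probability T R) (n : nat) (c delta V : R).
Hypotheses (n0 : (0 < n)%N) (c0 : 0 < c) (delta01 : 0 < delta < 1).

Let bound := 2 * V + c * Num.sqrt n%:R * Num.sqrt (2 * ln delta^-1).

(** The maximum of the centred sums has mean at most [2 * V] by symmetrization and changes by at
    most [c] with one sample point, so McDiarmid's inequality applies to it. *)
Lemma finite_class_deviation (I : finType) (i0 : I) (h : I -> T -> R) :
  (forall i, bmf (h i)) -> (forall i x y, `|h i x - h i y| <= c) ->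
  (forall s : n.-tuple T, avg n (fun e => smax i0 (fun i => ssum e s (h i))) <= V) ->
  (iid P n [set s | exists i, bound <= \sum_(x <- s) (h i x - \int[P]_y h i y)]%R
    <= delta%:E)%E.
Proof.
move=> bh hc hV.
pose m i := \int[P]_y h i y.
have bm i : bmf (fun x => h i x - m i) by apply: bmfB => //; exact: bmf_cst.
pose Z (s : n.-tuple T) := smax i0 (fun i => 0 + \sum_(x <- s) (h i x - m i)).
have bZ : bmf Z.
  by apply: bmf_smax => i; apply: bmfD; [exact: bmf_cst|exact: bmf_tuple_sum].
have dZ k a : bdiff c (fun s : k.-tuple T =>
    smax i0 (fun i => a i + \sum_(x <- s) (h i x - m i))).
  elim: k a => [//|k IH] a /=; split.
    move=> x y s; apply: smax_lip => i; rewrite !big_cons.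
    by rewrite [X in `|X|](_ : _ = h i x - h i y)//; ring.
  move=> x; rewrite (_ : (fun s => _) = (fun s : k.-tuple T =>
    smax i0 (fun i => a i + (h i x - m i) + \sum_(x <- s) (h i x - m i))))//.
  by apply/funext => s; apply: eq_smax => i; rewrite big_cons addrA.
have := mcdiarmid P n0 c0 delta01 bZ (dZ n (fun=> 0)); apply: le_trans.
have EZ : \int[iid P n]_s Z s <= 2 * V.
  apply: le_trans (symmetrization P i0 bh n (fun=> 0)) _.
  rewrite -[leRHS](Rintegral_const (iid P n)); apply: Rintegral_le => [||s].
  - apply: bmf_avg => e; apply: bmf_smax => i; apply: bmfD; first exact: bmf_cst.
    exact/bmfZ/bmf_ssum.
  - exact: bmf_cst.
  - apply: (@le_trans _ _ (2 * avg n (fun e => smax i0 (fun i => ssum e s (h i)))));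
    last by rewrite ler_pM2l.
    rewrite -avgZ; apply: avg_le => e; apply: smax_le => i; rewrite add0r ler_pM2l//.
    exact: (le_smax i0 (fun i => ssum e s (h i))).
have mge k (F : n.-tuple T -> R) : bmf F -> measurable [set s | k <= F s].
  move=> [mF _]; rewrite (_ : [set s | _] = setT `&` F @^-1` `[k, +oo[%classic).
    exact: mF.
  by rewrite setTI; apply/seteqP; split => s /=; rewrite in_itv/= andbT.
have mB : measurable [set s : n.-tuple T | exists i, bound <= \sum_(x <- s) (h i x - m i)].
  rewrite (_ : [set s | _] = \bigcup_(i in [set: I]) [set s : n.-tuple T | bound <=
    \sum_(x <- s) (h i x - m i)]).
    by apply: fin_bigcup_measurable => // i _; apply: mge; exact: bmf_tuple_sum.
  by apply/seteqP; split => s /= [i]; [exists i|exists i].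
apply: le_measure; rewrite ?inE; [exact: mB|exact: mge|].
move=> s /= [i bi].
apply: (@le_trans _ _ bound); first by rewrite lerD2r.
apply: le_trans bi _; rewrite /Z.
by apply: le_trans (le_smax i0 _ i); rewrite add0r.
Qed.

(** The events of the finite subclasses increase to this one, and continuity from below preserves
    the bound because [V] is the same for every [N]. *)
Lemma countable_class_deviation (h : nat -> T -> R) :
  (forall i, bmf (h i)) -> (forall i x y, `|h i x - h i y| <= c) ->
  (forall N (s : n.-tuple T),
     avg n (fun e => smax ord0 (fun i : 'I_N.+1 => ssum e s (h i))) <= V) ->
  measurable [set s : n.-tuple T | exists i, bound <= \sum_(x <- s) (h i x - \int[P]_y h i y)] /\
  (iid P n [set s | exists i, bound <= \sum_(x <- s) (h i x - \int[P]_y h i y)]%R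
    <= delta%:E)%E.
Proof.
move=> bh hc hV.
pose m i := \int[P]_y h i y.
pose B N := [set s : n.-tuple T | exists i : 'I_N.+1, bound <= \sum_(x <- s) (h i x - m i)].
have bm i : bmf (fun x => h i x - m i) by apply: bmfB => //; exact: bmf_cst.
have mB N : measurable (B N).
  rewrite (_ : B N = \bigcup_(i in [set: 'I_N.+1]) [set s : n.-tuple T | bound <=
    \sum_(x <- s) (h i x - m i)]).
    apply: fin_bigcup_measurable => // i _.
    have [mF _] := bmf_tuple_sum n (bm i).
    rewrite (_ : [set s | _] = setT `&` (fun s : n.-tuple T => \sum_(x <- s)
      (h i x - m i)) @^-1` `[bound, +oo[%classic).
      exact: mF.
    by rewrite setTI; apply/seteqP; split => s /=; rewrite in_itv/= andbT.
  by apply/seteqP; split => s /= [i]; [exists i|exists i].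
have E : [set s : n.-tuple T | exists i, bound <= \sum_(x <- s) (h i x - \int[P]_y h i y)] =
    \bigcup_N B N.
  apply/seteqP; split => s /=.
    by move=> [i bi]; exists i => //; exists ord_max.
  by move=> [N _ [i bi]]; exists i.
split; first by rewrite E; exact: bigcup_measurable.
apply: (@le_trans _ _ (iid P n (\bigcup_N B N))); first by rewrite -E.
have ndB : nondecreasing_seq B.
  move=> N N' NN'; rewrite subsetEset => s [i bi].
  by exists (widen_ord (NN' : (N.+1 <= N'.+1)%N) i).
have := nondecreasing_cvg_mu (mu := iid P n) mB (bigcup_measurable (fun k _ => mB k)) ndB.
move=> cv; rewrite [leLHS](_ : _ = limn (iid P n \o B)); last first.
  apply: esym; apply: cvg_lim; first exact: ereal_hausdorff.
  exact: cv.
apply: lime_le; first by apply/cvg_ex; eexists; exact: cv.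
apply: nearW => N /=.
by apply: (@finite_class_deviation _ ord0 (fun i : 'I_N.+1 => h i)).
Qed.

End uniform_deviation.

(** * Features of the network *)

Section activation.
Context {R : realType}.
Implicit Types y z : R.

Let pos z : R := Num.max z 0.

Lemma actE z : act z = 6^-1 * Num.max z 0 ^+ 3.
Proof.
rewrite /act; have [z0|z0] := leP z 0.
  rewrite expr0n/= mulr0; apply: max_r.
  by rewrite pmulr_rle0 ?invr_gt0//; have := sqr_ge0 z; rewrite !exprS expr0; nra.
by apply: max_l; rewrite mulr_ge0// exprn_ge0// ltW.
Qed.

Let pos_ge0 z : 0 <= pos z. Proof. by rewrite /pos le_max lexx orbT. Qed.

Let pos_le_norm z : pos z <= `|z|.
Proof. by rewrite /pos ge_max normr_ge0 ler_norm. Qed.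

Let pos_lip y z : `|pos y - pos z| <= `|y - z|.
Proof.
rewrite /pos; have [y0|y0] := leP y 0; have [z0|z0] := leP z 0;
 by rewrite ?subrr ?normr0 ?normr_ge0//; rewrite ler_norml; apply/andP; split;
  case: (ger0P (y - z)) => ?; lra.
Qed.

Lemma act2_lip y z : `|act2 y - act2 z| <= `|y - z|.
Proof. exact: pos_lip. Qed.

Lemma act1_lip y z : `|y| <= 1 -> `|z| <= 1 -> `|act1 y - act1 z| <= `|y - z|.
Proof.
move=> y1 z1; have py := le_trans (pos_le_norm y) y1.
have pz := le_trans (pos_le_norm z) z1.
apply: le_trans (pos_lip y z); rewrite /act1 -/(pos y) -/(pos z).
have -> : 2^-1 * pos y ^+ 2 - 2^-1 * pos z ^+ 2 =
   (pos y - pos z) * ((pos y + pos z) / 2) by field.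
rewrite normrM ler_piMr// ger0_norm; have := pos_ge0 y; have := pos_ge0 z; lra.
Qed.

Lemma act_lip y z : `|y| <= 1 -> `|z| <= 1 -> `|act y - act z| <= 2^-1 * `|y - z|.
Proof.
move=> y1 z1; have py := le_trans (pos_le_norm y) y1.
have pz := le_trans (pos_le_norm z) z1.
have y0 := pos_ge0 y; have z0 := pos_ge0 z.
have := pos_lip y z; rewrite !actE -/(pos y) -/(pos z).
have -> : 6^-1 * pos y ^+ 3 - 6^-1 * pos z ^+ 3 =
   (pos y - pos z) * ((pos y ^+ 2 + pos y * pos z + pos z ^+ 2) / 6) by field.
move: py pz y0 z0; set p := pos y; set q := pos z => p1 q1 p0 q0 pq.
have e0 : 0 <= p * q by rewrite mulr_ge0.
have e1 : p * q <= 1 by rewrite mulr_ile1.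
have e2 : 0 <= p ^+ 2 <= 1 by rewrite sqr_ge0 exprn_ile1.
have e3 : 0 <= q ^+ 2 <= 1 by rewrite sqr_ge0 exprn_ile1.
rewrite normrM mulrC; apply: ler_pM => //.
by rewrite ger0_norm; lra.
Qed.

Lemma act2_bound z : 0 <= act2 z <= `|z|.
Proof. by rewrite pos_ge0 pos_le_norm. Qed.

Lemma act1_bound z : 0 <= act1 z <= 2^-1 * `|z| ^+ 2.
Proof.
rewrite /act1 mulr_ge0 ?sqr_ge0//= ler_pM2l ?invr_gt0// ler_sqr ?nnegrE//.
  exact: pos_le_norm.
exact: pos_ge0.
Qed.

Lemma act_bound z : 0 <= act z <= 6^-1 * `|z| ^+ 3.
Proof.
rewrite actE mulr_ge0 ?exprn_ge0 ?pos_ge0//= ler_pM2l ?invr_gt0//.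
by rewrite lerXn2r ?nnegrE ?pos_ge0 ?pos_le_norm.
Qed.

Lemma act2_homo k z : 0 <= k -> act2 (k * z) = k * act2 z.
Proof. by move=> k0; rewrite /act2 maxr_pMr// mulr0. Qed.

Lemma act1_homo k z : 0 <= k -> act1 (k * z) = k ^+ 2 * act1 z.
Proof.
move=> k0; rewrite /act1 -[Num.max (k * z) 0]/(act2 (k * z)) act2_homo// exprMn.
by rewrite /act2; ring.
Qed.

Lemma act_homo k z : 0 <= k -> act (k * z) = k ^+ 3 * act z.
Proof.
move=> k0; rewrite !actE -[Num.max (k * z) 0]/(act2 (k * z)) act2_homo// exprMn.
by rewrite /act2; ring.
Qed.

End activation.

Section features.
Context {R : realType} {d : nat}.
Variables (M : R) (A : 'rV[R]_d -> 'M[R]_d) (b : 'rV[R]_d -> 'rV[R]_d).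
Variables (c : 'rV[R]_d -> R).
Hypothesis M1 : 1 <= M.
Hypothesis A_bnd : forall x, cube x -> forall i j, `|A x i j| <= M.
Hypothesis b_bnd : forall x, cube x -> forall i, `|b x 0 i| <= M.
Hypothesis c_bnd : forall x, cube x -> `|c x| <= M.
Implicit Types (w x : 'rV[R]_d).

Let M0 : 0 <= M. Proof. exact: le_trans M1. Qed.

(** Separates the polynomial weights in [w] from functions of [dotr w x]: on the unit l1 ball the
    weights are at most 1 and can be pulled out of a signed sum, leaving terms to which contraction
    applies. *)
Lemma featureE w x : feature A b c w x =
  (\sum_i \sum_j w 0 i * w 0 j * (A x i j * act2 (dotr w x)))
  + \sum_i w 0 i * (b x 0 i * act1 (dotr w x)) + c x * act (dotr w x).
Proof.
rewrite /feature; congr (_ + _ + _).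
  rewrite mxE big_distrl /= exchange_big /=; apply: eq_bigr => j _.
  rewrite mxE big_distrl big_distrl /=; apply: eq_bigr => i _.
  by rewrite mxE; ring.
by rewrite /dotr big_distrl /=; apply: eq_bigr => i _; ring.
Qed.

Lemma dotr_bound w x : cube x -> `|dotr w x| <= l1norm w.
Proof.
move=> cx; apply: le_trans (ler_norm_sum _ _ _) _; apply: ler_sum => i _.
by rewrite normrM ler_piMr//; have /andP[x0 x1] := cx i; rewrite ger0_norm.
Qed.

Lemma l1norm_ge0 w : 0 <= l1norm w.
Proof. by apply: sumr_ge0 => i _. Qed.

Lemma coord_le_l1norm w i : `|w 0 i| <= l1norm w.
Proof. by rewrite /l1norm (bigD1 i)//= lerDl sumr_ge0. Qed.

(** The three terms contribute 1, 1/2 and 1/6 times M |w|^3; the sum 5/3 is rounded up to 2. *)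
Lemma feature_bound w x : cube x -> `|feature A b c w x| <= 2 * M * l1norm w ^+ 3.
Proof.
move=> cx; set l := l1norm w; have l0 : 0 <= l := l1norm_ge0 w.
have dl : `|dotr w x| <= l by exact: dotr_bound.
have d0 := normr_ge0 (dotr w x).
have a2 : `|act2 (dotr w x)| <= l.
  by have /andP[? ?] := act2_bound (dotr w x); rewrite ger0_norm//; exact: le_trans dl.
have a1 : `|act1 (dotr w x)| <= 2^-1 * l ^+ 2.
  have /andP[? H] := act1_bound (dotr w x); rewrite ger0_norm//; apply: le_trans H _.
  by rewrite ler_pM2l ?invr_gt0// lerXn2r.
have a0 : `|act (dotr w x)| <= 6^-1 * l ^+ 3.
  have /andP[? H] := act_bound (dotr w x); rewrite ger0_norm//; apply: le_trans H _.
  by rewrite ler_pM2l ?invr_gt0// lerXn2r.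
rewrite featureE; apply: le_trans (ler_normD _ _) _.
apply: le_trans (lerD (ler_normD _ _) (lexx _)) _.
have T1 : `|\sum_i \sum_j w 0 i * w 0 j * (A x i j * act2 (dotr w x))| <= l * l * (M * l).
  apply: le_trans (ler_norm_sum _ _ _) _.
  apply: (@le_trans _ _ (\sum_i \sum_j `|w 0 i| * `|w 0 j| * (M * l))).
    apply: ler_sum => i _; apply: le_trans (ler_norm_sum _ _ _) _; apply: ler_sum => j _.
    by rewrite !normrM ler_wpM2l ?mulr_ge0// ler_pM// A_bnd.
  move: (M * l) => K; rewrite le_eqVlt; apply/orP; left; apply/eqP; rewrite /l /l1norm.
  rewrite -mulrA big_distrl /=; apply: eq_bigr => i _.
  by rewrite big_distrl big_distrr /=; apply: eq_bigr => j _; rewrite mulrA.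
have T2 : `|\sum_i w 0 i * (b x 0 i * act1 (dotr w x))| <= l * (M * (2^-1 * l ^+ 2)).
  apply: le_trans (ler_norm_sum _ _ _) _; rewrite {1}/l {1}/l1norm big_distrl /=.
  by apply: ler_sum => i _; rewrite normrM ler_wpM2l// normrM ler_pM// b_bnd.
have T3 : `|c x * act (dotr w x)| <= M * (6^-1 * l ^+ 3).
  by rewrite normrM ler_pM// c_bnd.
have : 0 <= M * l ^+ 3 by rewrite mulr_ge0// exprn_ge0.
have E1 : l * l * (M * l) = M * l ^+ 3 by ring.
have E2 : l * (M * (2^-1 * l ^+ 2)) = 2^-1 * (M * l ^+ 3) by ring.
rewrite E1 in T1; rewrite E2 in T2.
by move: T1 T2 T3; rewrite [M * (_ * _)]mulrCA -[2 * M * _]mulrA; lra.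
Qed.

Lemma dotrZ k w x : dotr (k *: w) x = k * dotr w x.
Proof. by rewrite /dotr big_distrr /=; apply: eq_bigr => i _; rewrite mxE mulrA. Qed.

(** Each term has total degree 3 in [w], as 2 + 1, 1 + 2 and 0 + 3. This is why the path norm weighs
    a neuron by the cube of its l1 norm. *)
Lemma feature_homo k w x : 0 <= k ->
  feature A b c (k *: w) x = k ^+ 3 * feature A b c w x.
Proof.
move=> k0; rewrite /feature dotrZ act2_homo// act1_homo// act_homo//.
have -> : dotr (b x) (k *: w) = k * dotr (b x) w.
  by rewrite /dotr big_distrr /=; apply: eq_bigr => i _; rewrite mxE mulrCA.
by rewrite linearZ /= -scalemxAl -scalemxAl -scalemxAr !mxE; ring.
Qed.

Lemma l1normZ k w : l1norm (k *: w) = `|k| * l1norm w.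
Proof. by rewrite /l1norm big_distrr; apply: eq_bigr => i _; rewrite mxE normrM. Qed.

(** If [l1norm w] is 0 its inverse is 0 as well, so the direction is 0; its norm is thus only known
    to be at most 1. *)
Definition unit_dir w := (l1norm w)^-1 *: w.

Lemma unit_dir_le1 w : l1norm (unit_dir w) <= 1.
Proof.
rewrite l1normZ ger0_norm ?invr_ge0 ?l1norm_ge0//.
have [->|w0] := eqVneq (l1norm w) 0; first by rewrite mulr0.
by rewrite mulVf.
Qed.

Lemma feature_unit_dir w x :
  feature A b c w x = l1norm w ^+ 3 * feature A b c (unit_dir w) x.
Proof.
rewrite -feature_homo ?l1norm_ge0//; congr feature.
have [w0|w0] := eqVneq (l1norm w) 0; last by rewrite /unit_dir scalerA mulfV// scale1r.
rewrite w0 scale0r; apply/rowP => i; rewrite mxE; apply/eqP.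
by rewrite -normr_le0 -w0 coord_le_l1norm.
Qed.

Section rademacher.
Variables (T : Type) (xi : T -> 'rV[R]_d) (s : seq T).
Hypothesis xi_cube : forall t, cube (xi t).
Hypothesis d0 : (0 < d)%N.

Let sn : R := Num.sqrt (size s)%:R.
Let r : R := Num.sqrt (2 * ln (2 * d%:R)).

(** The signed sum is linear in the direction, so on the l1 ball it is at most the largest of its
    [d] coordinates in absolute value. However many directions there are, the finite class bound is
    applied to [d] functions only. *)
Lemma rademacher_linear (I : finType) (i0 : I) (u : I -> 'rV[R]_d) L :
  0 <= L -> (forall i, l1norm (u i) <= 1) ->
  avg (size s) (fun e => smax i0 (fun i => ssum e s (fun t => L * dotr (u i) (xi t))))
  <= L * sn * r.
Proof.
move=> L0 u1; rewrite /sn /r.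
have -> : d%:R = #|'I_d|%:R :> R by rewrite card_ord.
apply: (avg_finite_class (h := fun (j : 'I_d) t => L * xi t 0 j)) => //.
- by rewrite card_ord.
- move=> j t _; rewrite normrM ger0_norm// ler_piMr//.
  by have /andP[x0 x1] := xi_cube t j; rewrite ger0_norm.
- move=> e; have [i ->] := smax_attained i0 (fun i => ssum e s (fun t => L * dotr (u i) (xi t))).
  have [j jmax] := smax_attained (Ordinal d0) (fun j => `|ssum e s (fun t => L * xi t 0 j)|).
  exists j; rewrite -jmax; set B := smax _ _.
  have B0 : 0 <= B by rewrite /B jmax.
  rewrite (_ : ssum e s _ = \sum_k u i 0 k * ssum e s (fun t => L * xi t 0 k)); last first.
    under [RHS]eq_bigr do rewrite -ssumZ.
    rewrite -ssum_sum; apply: eq_ssum => t; rewrite /dotr big_distrr /=.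
    by apply: eq_bigr => k _; rewrite mulrCA.
  apply: (@le_trans _ _ (l1norm (u i) * B)); last by rewrite ler_piMl.
  rewrite /l1norm big_distrl /=; apply: ler_sum => k _.
  apply: le_trans (ler_norm _) _; rewrite normrM ler_wpM2l//.
  exact: (le_smax (Ordinal d0) (fun j => `|ssum e s (fun t => L * xi t 0 j)|)).
Qed.

(* Adding the zero vector to the class makes both one-sided suprema nonnegative,
   so that the two-sided supremum is at most their sum. *)
Lemma rademacher_abs (I : finType) (i0 : I) (u : I -> 'rV[R]_d) (kappa : T -> R)
    (psi : R -> R) L :
  0 <= L -> psi 0 = 0 -> (forall i, l1norm (u i) <= 1) ->
  (forall t y z, `|y| <= 1 -> `|z| <= 1 ->
     `|kappa t * psi y - kappa t * psi z| <= L * `|y - z|) ->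
  avg (size s) (fun e => smax i0 (fun i =>
    `|ssum e s (fun t => kappa t * psi (dotr (u i) (xi t)))|)) <= 2 * (L * sn * r).
Proof.
move=> L0 psi0 u1 lip.
pose v (o : option I) := if o is Some i then u i else 0.
have v1 o : l1norm (v o) <= 1.
  case: o => [i|] //=; rewrite /l1norm big1// => i _.
  by rewrite mxE normr0.
pose g o t := kappa t * psi (dotr (v o) (xi t)).
have dv o t : `|dotr (v o) (xi t)| <= 1 by exact: le_trans (dotr_bound _ (xi_cube t)) (v1 o).
have gN t : g None t = 0.
  rewrite /g /= [dotr _ _](_ : _ = 0) ?psi0 ?mulr0//.
  by rewrite /dotr big1// => i _; rewrite mxE mul0r.
have C (h : option I -> T -> R) :
    (forall o o' t, `|h o t - h o' t| <= `|L * dotr (v o) (xi t) - L * dotr (v o') (xi t)|) ->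
    avg (size s) (fun e => smax None (fun o => ssum e s (h o))) <= L * sn * r.
  move=> hL; apply: le_trans (rademacher_linear None L0 v1).
  have := @avg_contraction _ _ None _ s h (fun o t => L * dotr (v o) (xi t)) (fun=> 0).
  have E (F : seq bool -> option I -> R) :
      avg (size s) (fun e => smax None (fun o => 0 + F e o)) =
      avg (size s) (fun e => smax None (F e)).
    by apply: eq_avg => e; apply: eq_smax => o; rewrite add0r.
  rewrite (E (fun e o => ssum e s (h o))).
  rewrite (E (fun e o => ssum e s (fun t => L * dotr (v o) (xi t)))).
  by apply => t _ o o'; exact: hL.
apply: (@le_trans _ _ (avg (size s) (fun e => smax None (fun o => ssum e s (g o))
   + smax None (fun o => ssum e s (fun t => - g o t))))).
  apply: avg_le => e; apply: smax_le => i.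
  have := le_smax None (fun o => ssum e s (g o)) (Some i).
  have := le_smax None (fun o => ssum e s (g o)) None.
  have := le_smax None (fun o => ssum e s (fun t => - g o t)) (Some i).
  have := le_smax None (fun o => ssum e s (fun t => - g o t)) None.
  rewrite /= !ssumN (eq_ssum _ _ gN) ssum0 oppr0 -[ssum e s (fun t => _)]/(ssum e s (g (Some i))).
  by case: (ger0P (ssum e s (g (Some i)))) => _; lra.
have glip o o' t : `|g o t - g o' t| <= `|L * dotr (v o) (xi t) - L * dotr (v o') (xi t)|.
  by rewrite -[in leRHS]mulrBr [in leRHS]normrM (ger0_norm L0); exact: lip.
rewrite avgD mulr_natl mulr2n; apply: lerD; apply: C => // o o' t.
by rewrite (_ : - g o t - - g o' t = - (g o t - g o' t)) ?normrN//; ring.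
Qed.

(** With K = M sn r, each of the d^2 second-order and d first-order terms costs 2 K. The term of
    order zero costs K, since [act] is 1/2-Lipschitz on [-1, 1]. In all 2 d^2 + 2 d + 1 <= 5 d^2. *)
Lemma rademacher_feature (I : finType) (i0 : I) (u : I -> 'rV[R]_d) :
  (forall i, l1norm (u i) <= 1) ->
  avg (size s) (fun e => smax i0 (fun i =>
    `|ssum e s (fun t => feature A b c (u i) (xi t))|)) <= 5 * d%:R ^+ 2 * M * sn * r.
Proof.
move=> u1.
pose S2 i j e := smax i0 (fun k => `|ssum e s (fun t => A (xi t) i j * act2 (dotr (u k) (xi t)))|).
pose S1 i e := smax i0 (fun k => `|ssum e s (fun t => b (xi t) 0 i * act1 (dotr (u k) (xi t)))|).
pose S0 e := smax i0 (fun k => `|ssum e s (fun t => c (xi t) * act (dotr (u k) (xi t)))|).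
apply: (@le_trans _ _ (avg (size s) (fun e =>
   (\sum_i \sum_j S2 i j e) + (\sum_i S1 i e) + S0 e))).
  apply: avg_le => e; apply: smax_le => k.
  rewrite (eq_ssum _ _ (fun t => featureE (u k) (xi t))) !ssumD.
  have uk i : `|u k 0 i| <= 1 by exact: le_trans (coord_le_l1norm _ _) (u1 k).
  apply: le_trans (ler_normD _ _) _; apply: lerD; last first.
    exact: (le_smax i0 (fun k => `|ssum e s (fun t => c (xi t) * act (dotr (u k) (xi t)))|)).
  apply: le_trans (ler_normD _ _) _; apply: lerD.
    rewrite ssum_sum; apply: le_trans (ler_norm_sum _ _ _) _; apply: ler_sum => i _.
    rewrite ssum_sum; apply: le_trans (ler_norm_sum _ _ _) _; apply: ler_sum => j _.
    rewrite ssumZ !normrM.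
    apply: le_trans (le_smax i0 (fun k => `|ssum e s (fun t => A (xi t) i j * act2 (dotr (u k)
      (xi t)))|) k).
    by rewrite ler_piMl// mulr_ile1.
  rewrite ssum_sum; apply: le_trans (ler_norm_sum _ _ _) _; apply: ler_sum => i _.
  rewrite ssumZ !normrM.
  apply: le_trans (le_smax i0 (fun k => `|ssum e s (fun t => b (xi t) 0 i * act1 (dotr (u k)
    (xi t)))|) k).
  by rewrite ler_piMl.
rewrite !avgD !avg_sum.
have B2 i j : avg (size s) (S2 i j) <= 2 * (M * sn * r).
  apply: rademacher_abs => //; first by rewrite /act2 maxxx.
  by move=> t y z _ _; rewrite -mulrBr normrM ler_pM// ?A_bnd// act2_lip.
have B1 i : avg (size s) (S1 i) <= 2 * (M * sn * r).
  apply: rademacher_abs => //; first by rewrite /act1 maxxx expr0n/= mulr0.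
  by move=> t y z y1 z1; rewrite -mulrBr normrM ler_pM// ?b_bnd// act1_lip.
have B0 : avg (size s) S0 <= 2 * (M * 2^-1 * sn * r).
  apply: rademacher_abs => //.
  - by rewrite mulr_ge0.
  - by rewrite actE maxxx expr0n/= mulr0.
  by move=> t y z y1 z1; rewrite -mulrBr normrM -mulrA ler_pM// ?c_bnd// act_lip.
set K := M * sn * r in B1 B2.
have K0 : 0 <= K by rewrite !mulr_ge0// sqrtr_ge0.
apply: (@le_trans _ _ (d%:R ^+ 2 * (2 * K) + d%:R * (2 * K) + K)).
  apply: lerD; last by apply: le_trans B0 _; rewrite le_eqVlt /K; apply/orP; left; apply/eqP; field.
  apply: lerD.
    apply: (@le_trans _ _ (\sum_(i < d) \sum_(j < d) (2 * K))).
      by apply: ler_sum => i _; rewrite avg_sum; apply: ler_sum => j _; exact: B2.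
    by move: (2 * K) => q; rewrite !sumr_const !card_ord -mulrnA -[q *+ _]mulr_natl natrM expr2.
  apply: (@le_trans _ _ (\sum_(i < d) (2 * K))).
    by apply: ler_sum => i _; exact: B1.
  by move: (2 * K) => q; rewrite sumr_const card_ord -[q *+ _]mulr_natl.
have d1 : (1 : R) <= d%:R by rewrite ler1n.
have -> : 5 * d%:R ^+ 2 * M * sn * r = 5 * d%:R ^+ 2 * K by rewrite /K; ring.
have h1 : d%:R * K <= d%:R ^+ 2 * K by rewrite ler_wpM2r// expr2 ler_peMr.
have h2 : K <= d%:R * K by rewrite ler_peMl.
by nra.
Qed.

End rademacher.
End features.

(** * Measurability and clipping to the cube *)

Section measurability.
Context {R : realType} {d : nat}.

Lemma measurable_cube : measurable (@pt R d @^-1` cube).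
Proof.
pose A (_ : 'I_d) : set R := `[0, 1]%classic.
rewrite (_ : _ @^-1` _ = [set t : d.-tuple R | forall i, A i (tnth t i)]).
  by apply: measurable_box => i; exact: measurable_itv.
by apply/seteqP; split=> t /= h i; have := h i; rewrite /A /pt /= mxE in_itv.
Qed.

Lemma cube0 : cube (0 : 'rV[R]_d).
Proof. by move=> i; rewrite mxE lexx ler01. Qed.

(* Sample points outside the cube (a null set) are sent to the origin, so that
   all bounds hold everywhere. *)
Definition clip (t : d.-tuple R) : 'rV[R]_d := if t \in pt @^-1` cube then pt t else 0.

Lemma clip_cube t : cube (clip t).
Proof. by rewrite /clip; case: ifPn => [|_]; [rewrite inE|exact: cube0]. Qed.

Lemma clipE t : cube (pt t) -> clip t = pt t.
Proof. by move=> ct; rewrite /clip mem_set. Qed.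

Lemma measurable_clip (g : 'rV[R]_d -> R) :
  measurable_fun (pt @^-1` cube) (fun t => g (pt t)) ->
  measurable_fun setT (fun t => g (clip t)).
Proof.
move=> mg; rewrite (_ : (fun t => g (clip t)) =
    (((fun t => g (pt t) - g 0) \_ (pt @^-1` cube)) \+ cst (g 0))).
  apply: measurable_funD; last exact: measurable_cst.
  apply/(measurable_restrictT _ measurable_cube).
  by apply: measurable_funB => //; exact: measurable_cst.
by apply/funext => t; rewrite /clip /= patchE; case: ifP => _; rewrite ?subrK ?add0r.
Qed.

Lemma measurable_clip_coord i : measurable_fun setT (fun t => clip t 0 i).
Proof.
apply: (measurable_clip (g := fun x => x 0 i)).
rewrite (_ : (fun t => _) = (fun t : d.-tuple R => tnth t i)).
  by apply: measurable_funTS; exact: (measurable_tnth i).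
by apply/funext => t; rewrite mxE.
Qed.

(** Direction and point may both depend on [u]: a network has fixed directions and a random point,
    whereas the integral representation needs joint measurability in both. *)
Lemma measurable_feature dU (U : measurableType dU) (W X : U -> 'rV[R]_d)
    (A : 'rV[R]_d -> 'M[R]_d) (b : 'rV[R]_d -> 'rV[R]_d) (c : 'rV[R]_d -> R) :
  (forall i, measurable_fun setT (fun u => W u 0 i)) ->
  (forall i, measurable_fun setT (fun u => X u 0 i)) ->
  (forall i j, measurable_fun setT (fun u => A (X u) i j)) ->
  (forall i, measurable_fun setT (fun u => b (X u) 0 i)) ->
  measurable_fun setT (fun u => c (X u)) ->
  measurable_fun setT (fun u => feature A b c (W u) (X u)).
Proof.
move=> mW mX mA mb mc.
have md : measurable_fun setT (fun u => dotr (W u) (X u)).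
  by apply: measurable_sum => i; exact: measurable_funM.
have m2 : measurable_fun setT (fun u => act2 (dotr (W u) (X u))).
  by apply: measurable_maxr => //; exact: measurable_cst.
have m1 : measurable_fun setT (fun u => act1 (dotr (W u) (X u))).
  by apply: measurable_funM; [exact: measurable_cst|exact: measurable_funX].
have m0 : measurable_fun setT (fun u => act (dotr (W u) (X u))).
  apply: measurable_maxr; last exact: measurable_cst.
  by apply: measurable_funM; [exact: measurable_cst|exact: measurable_funX].
under eq_fun do rewrite featureE.
apply: measurable_funD; last exact: measurable_funM.
apply: measurable_funD; apply: measurable_sum => i.
  apply: measurable_sum => j; apply: measurable_funM; exact: measurable_funM.
by apply: measurable_funM => //; exact: measurable_funM.
Qed.

End measurability.

(** * Residuals normalized by the path norm *)

Section network_class.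
Context {R : realType} {d m : nat}.
Variables (M : R) (A : 'rV[R]_d -> 'M[R]_d) (b : 'rV[R]_d -> 'rV[R]_d).
Variables (c f : 'rV[R]_d -> R).
Hypothesis M1 : 1 <= M.
Hypothesis A_bnd : forall x, cube x -> forall i j, `|A x i j| <= M.
Hypothesis b_bnd : forall x, cube x -> forall i, `|b x 0 i| <= M.
Hypothesis c_bnd : forall x, cube x -> `|c x| <= M.
Hypothesis f_bnd : forall x, cube x -> `|f x| <= 1.
Hypothesis d0 : (0 < d)%N.
Hypothesis m0 : (0 < m)%N.
Implicit Types (theta : params (R := R) (d := d) m) (x : 'rV[R]_d).

Let M0 : 0 <= M. Proof. exact: le_trans M1. Qed.

Definition pde_network theta x : R :=
  \sum_(k < m) theta.1 0 k * feature A b c (row k theta.2) x.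

Definition residual theta x : R := pde_network theta x - f x.

Definition normalized_residual theta x : R := residual theta x / (path_norm theta + 1).

Lemma path_norm_ge0 theta : 0 <= path_norm theta.
Proof. by apply: sumr_ge0 => k _; rewrite mulr_ge0// exprn_ge0// l1norm_ge0. Qed.

Let Q1 theta : 0 < path_norm theta + 1.
Proof. by rewrite ltr_wpDl// path_norm_ge0. Qed.

Lemma pde_network_bound theta x : cube x ->
  `|pde_network theta x| <= 2 * M * path_norm theta.
Proof.
move=> cx; apply: le_trans (ler_norm_sum _ _ _) _.
rewrite /path_norm big_distrr /=; apply: ler_sum => k _.
by rewrite normrM mulrCA ler_wpM2l//; exact: feature_bound.
Qed.

Lemma residual_bound theta x : cube x ->
  `|residual theta x| <= 2 * M * (path_norm theta + 1).
Proof.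
move=> cx; apply: le_trans (ler_normB _ _) _.
have := pde_network_bound theta cx; have := f_bnd cx.
by rewrite mulrDr mulr1 => h1 h2; have := M1; lra.
Qed.

Lemma normalized_residual_bound theta x : cube x ->
  `|normalized_residual theta x| <= 2 * M.
Proof.
move=> cx; rewrite /normalized_residual normrM normfV (gtr0_norm (Q1 theta)).
by rewrite ler_pdivrMr//; exact: residual_bound.
Qed.

Section rademacher.
Variables (T : Type) (xi : T -> 'rV[R]_d) (s : seq T).
Hypothesis xi_cube : forall t, cube (xi t).
Variables (I : finType) (i0 : I) (th : I -> params (R := R) (d := d) m).

Let sn : R := Num.sqrt (size s)%:R.
Let r : R := Num.sqrt (2 * ln (2 * d%:R)).

(** The neurons carry total weight [path_norm] in absolute value and [f] carries weight 1. After
    division by [path_norm + 1] the signed sum is at most [F e + G e], whatever the parameters. *)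
Lemma rademacher_normalized_residual :
  avg (size s) (fun e => smax i0 (fun i => ssum e s (fun t => normalized_residual (th i) (xi t))))
  <= (5 * d%:R ^+ 2 * M + 1) * sn * r.
Proof.
(* All neurons of all networks of the class form one finite family of directions. *)
pose u (p : I * 'I_m) := unit_dir (row p.2 (th p.1).2).
pose p0 := (i0, Ordinal m0).
pose F e := smax p0 (fun p => `|ssum e s (fun t => feature A b c (u p) (xi t))|).
pose G e := `|ssum e s (fun t => f (xi t))|.
apply: (@le_trans _ _ (avg (size s) (fun e => F e + G e))).
  apply: avg_le => e; apply: smax_le => i.
  have F0 : 0 <= F e.
    by apply: le_trans (le_smax p0 _ p0).
  rewrite (eq_ssum _ _ (g := fun t => (path_norm (th i) + 1)^-1 *
    (\sum_(k < m) ((th i).1 0 k * l1norm (row k (th i).2) ^+ 3) *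
        feature A b c (u (i, k)) (xi t) + - f (xi t)))); last first.
    move=> t; rewrite /normalized_residual mulrC; congr (_ * (_ - _)).
    by apply: eq_bigr => k _; rewrite -mulrA -feature_unit_dir.
  rewrite ssumZ ssumD ssumN ssum_sum ler_pdivrMl// mulrDl mul1r.
  apply: lerD; last first.
    apply: (@le_trans _ _ (G e)); first by rewrite /G -normrN ler_norm.
    by rewrite lerDr.
  rewrite mulrDr; apply: ler_wpDr; first by rewrite mulr_ge0 ?path_norm_ge0 /G.
  rewrite /path_norm big_distrl /=; apply: ler_sum => k _.
  rewrite ssumZ; apply: le_trans (ler_norm _) _.
  rewrite normrM [X in X * _]normrM (ger0_norm (exprn_ge0 3 (l1norm_ge0 _))) ler_wpM2l//.
    by rewrite mulr_ge0// exprn_ge0// l1norm_ge0.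
  exact: (le_smax p0 (fun p => `|ssum e s (fun t => feature A b c (u p) (xi t))|) (i, k)).
rewrite avgD (_ : _ * sn * r = 5 * d%:R ^+ 2 * M * sn * r + 1 * sn * r); last by ring.
apply: lerD.
  by apply: rademacher_feature => // p; exact: unit_dir_le1.
(* [f] is treated as a class of one function bounded by 1; ln 2 is then enlarged to ln (2 d) to
   share the factor [r]. *)
have : 1 * sn * Num.sqrt (2 * ln (2 * #|{: unit}|%:R)) <= 1 * sn * r.
  rewrite !mul1r ler_wpM2l ?sqrtr_ge0// card_unit ler_wsqrtr// ler_pM2l//.
  have d1 : (1 : R) <= d%:R by rewrite ler1n.
  by rewrite ler_ln ?posrE; lra.
apply: le_trans.
apply: (avg_finite_class (h := fun (_ : unit) t => f (xi t))) => //.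
- by rewrite card_unit.
- by move=> _ t _; exact: f_bnd.
Qed.

(** Squaring is 4 M-Lipschitz on [-2 M, 2 M], so contraction removes the square. The minus sign is
    there because the bound sought is on expectation minus empirical mean. *)
Lemma rademacher_squared_residual :
  avg (size s) (fun e => smax i0 (fun i =>
    ssum e s (fun t => - normalized_residual (th i) (xi t) ^+ 2)))
  <= 4 * M * ((5 * d%:R ^+ 2 * M + 1) * sn * r).
Proof.
apply: (@le_trans _ _ (avg (size s) (fun e => smax i0 (fun i =>
    ssum e s (fun t => 4 * M * normalized_residual (th i) (xi t)))))).
  have := @avg_contraction _ _ i0 _ s
    (fun i t => - normalized_residual (th i) (xi t) ^+ 2)
    (fun i t => 4 * M * normalized_residual (th i) (xi t)) (fun=> 0).
  have E (F : seq bool -> I -> R) :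
      avg (size s) (fun e => smax i0 (fun o => 0 + F e o)) =
      avg (size s) (fun e => smax i0 (F e)).
    by apply: eq_avg => e; apply: eq_smax => o; rewrite add0r.
  rewrite (E (fun e i => ssum e s (fun t => - normalized_residual (th i) (xi t) ^+ 2))).
  rewrite (E (fun e i => ssum e s (fun t => 4 * M * normalized_residual (th i) (xi t)))).
  apply => t _ i j.
  have := normalized_residual_bound (th i) (xi_cube t).
  have := normalized_residual_bound (th j) (xi_cube t).
  set y := normalized_residual (th j) _; set z := normalized_residual (th i) _ => yM zM.
  rewrite (_ : - z ^+ 2 - - y ^+ 2 = - ((z + y) * (z - y))); last by ring.
  rewrite -[in leRHS]mulrBr normrN !normrM ler_wpM2r//.
  rewrite [X in _ <= X * _]ger0_norm// [X in _ <= _ * X]ger0_norm//.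
  by apply: le_trans (ler_normD _ _) _; lra.
apply: (@le_trans _ _ (4 * M * avg (size s) (fun e => smax i0 (fun i =>
    ssum e s (fun t => normalized_residual (th i) (xi t)))))).
  rewrite -avgZ; apply: avg_le => e; apply: smax_le => i.
  rewrite ssumZ ler_wpM2l ?mulr_ge0//.
  exact: (le_smax i0 (fun i => ssum e s (fun t => normalized_residual (th i) (xi t)))).
by rewrite ler_wpM2l ?mulr_ge0//; exact: rademacher_normalized_residual.
Qed.

End rademacher.
End network_class.

(** Makes [V = 0] admissible in the deviation bound for a single function. *)
Lemma avg_ssum {R : realType} n X (s : seq X) (h : X -> R) :
  avg n (fun e => ssum e s h) = 0.
Proof.
elim: n s => [|n IH] [|x s] //=.
  by rewrite !avg_cst addr0 mul0r.
rewrite !avgD !IH !avg_cst; lra.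
Qed.

(** [y] may be negative, with square root 0: it will be [ln (2 / (3 * delta))], negative once delta
    > 2/3. *)
Lemma sqrtrD_le {R : realType} (x y : R) : 0 <= x ->
  Num.sqrt (x + y) <= Num.sqrt x + Num.sqrt y.
Proof.
move=> x0; have [y0|y0] := leP 0 y.
  rewrite -(ler_pXn2r (n := 2)) ?nnegrE ?addr_ge0 ?sqrtr_ge0//.
  rewrite sqr_sqrtr ?addr_ge0// sqrrD !sqr_sqrtr//.
  have : 0 <= Num.sqrt x * Num.sqrt y by rewrite mulr_ge0 ?sqrtr_ge0.
  by rewrite mulr2n; lra.
by apply: ler_wpDr; rewrite ?sqrtr_ge0// ler_wsqrtr//; lra.
Qed.

Lemma probability_avoid {R : realType} d (T : measurableType d) (P : probability T R)
    (C U L : set T) (x y : R) :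
  measurable C -> measurable U -> measurable L -> P C = 1%E ->
  (P U <= x%:E)%E -> (P L <= y%:E)%E ->
  measurable (C `&` ~` U `&` ~` L) /\ ((1 - (x + y))%:E <= P (C `&` ~` U `&` ~` L))%E.
Proof.
move=> mC mU mL PC PU PL.
have mF : measurable (~` C `|` (U `|` L)).
  by apply: measurableU; [exact: measurableC|exact: measurableU].
rewrite (_ : C `&` _ `&` _ = ~` (~` C `|` (U `|` L))); last first.
  by rewrite !setCU setCK setIA.
split; first exact: measurableC.
rewrite probability_setC// EFinB leeB//.
apply: le_trans (measureU2 _ _ _) _; [exact: measurableC|exact: measurableU|].
have PC0 : (P (~` C) <= 0)%E by rewrite probability_setC// PC subee.
rewrite -[(x + y)%:E]add0e; apply: leeD; first exact: PC0.
apply: le_trans (measureU2 _ mU mL) _.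
by rewrite EFinD leeD.
Qed.

(** * The uniform law charges only the cube *)

Section uniform_law.
Context {R : realType}.

Lemma uniform01_itv : uniform01 (R := R) `[0, 1]%classic = 1%E.
Proof.
rewrite /uniform01 /distribution /= /pushforward /uniform_prob.
exact: integral_uniform_pdf1.
Qed.

Lemma uniform_cube_cube d : @uniform_cube R d (pt @^-1` cube) = 1%E.
Proof.
rewrite (_ : _ @^-1` _ = [set t : d.-tuple R | forall i, (fun=> `[0, 1]%classic : set R) i
  (tnth t i)]).
  rewrite (iid_box uniform01 (A := fun _ : 'I_d => `[0, 1]%classic : set R)).
    by rewrite big1// => i _; exact: uniform01_itv.
  by move=> i; exact: measurable_itv.
by apply/seteqP; split=> t /= h i; have := h i; rewrite /pt /= mxE in_itv.
Qed.

Lemma iid_uniform_cube_cube d n :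
  iid (@uniform_cube R d) n [set S | forall i, cube (pt (tnth S i))] = 1%E.
Proof.
rewrite (iid_box (@uniform_cube R d) (A := fun _ : 'I_n => @pt R d @^-1` cube)).
  by rewrite big1// => i _; exact: uniform_cube_cube.
by move=> i; exact: measurable_cube.
Qed.

End uniform_law.

(** * Uniform deviation of the risks of networks *)

Section network_deviation.
Context {R : realType} {d m n : nat}.
Variables (M : R) (A : 'rV[R]_d -> 'M[R]_d) (b : 'rV[R]_d -> 'rV[R]_d).
Variables (c f : 'rV[R]_d -> R).
Hypothesis M1 : 1 <= M.
Hypothesis mA : forall i j,
  measurable_fun (pt @^-1` cube) (fun t : d.-tuple R => A (pt t) i j).
Hypothesis mb : forall i,
  measurable_fun (pt @^-1` cube) (fun t : d.-tuple R => b (pt t) 0 i).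
Hypothesis mc : measurable_fun (pt @^-1` cube) (fun t : d.-tuple R => c (pt t)).
Hypothesis mf : measurable_fun setT (fun t : d.-tuple R => f (clip t)).
Hypothesis A_bnd : forall x, cube x -> forall i j, `|A x i j| <= M.
Hypothesis b_bnd : forall x, cube x -> forall i, `|b x 0 i| <= M.
Hypothesis c_bnd : forall x, cube x -> `|c x| <= M.
Hypothesis f_bnd : forall x, cube x -> `|f x| <= 1.
Hypothesis d0 : (0 < d)%N.
Hypothesis m0 : (0 < m)%N.
Hypothesis n0 : (0 < n)%N.
Implicit Types (theta : params (R := R) (d := d) m) (t : d.-tuple R).

Let P := @uniform_cube R d.
Let q theta t := normalized_residual A b c f theta (clip t).
Let res theta t := residual A b c f theta (clip t).

Lemma measurable_clip_feature dU (U : measurableType dU) (W : U -> 'rV[R]_d)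
    (X : U -> d.-tuple R) :
  (forall i, measurable_fun setT (fun u => W u 0 i)) -> measurable_fun setT X ->
  measurable_fun setT (fun u => feature A b c (W u) (clip (X u))).
Proof.
move=> mW mX; apply: (measurable_feature (X := fun u => clip (X u))) => //.
- by move=> i; exact: (measurableT_comp (measurable_clip_coord i) mX).
- by move=> i j; exact: (measurableT_comp (measurable_clip (g := fun x => A x i j) (mA i j)) mX).
- by move=> i; exact: (measurableT_comp (measurable_clip (g := fun x => b x 0 i) (mb i)) mX).
- exact: (measurableT_comp (measurable_clip mc) mX).
Qed.

Lemma bmf_residual theta : bmf (res theta).
Proof.
split; last first.
  exists (2 * M * (path_norm theta + 1)) => t.
  by apply: (residual_bound (M := M)) => //; exact: clip_cube.
apply: measurable_funB => //; apply: measurable_sum => k.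
apply: measurable_funM; first exact: measurable_cst.
by apply: (measurable_clip_feature (W := fun=> row k theta.2)) => // i; exact: measurable_cst.
Qed.

Lemma bmf_normalized_residual theta : bmf (q theta).
Proof.
rewrite /q /normalized_residual; under eq_fun do rewrite mulrC.
exact/bmfZ/bmf_residual.
Qed.

Let bmf_sq (g : d.-tuple R -> R) : bmf g -> bmf (fun t : d.-tuple R => g t ^+ 2).
Proof. by move=> bg; under eq_fun do rewrite expr2; exact: bmfM. Qed.

Let sq_dev theta t u : `|q theta t ^+ 2 - q theta u ^+ 2| <= 4 * M ^+ 2.
Proof.
have B v : 0 <= q theta v ^+ 2 <= 4 * M ^+ 2.
  rewrite sqr_ge0 /= -[leLHS]ger0_norm ?sqr_ge0// normrX.
  have -> : 4 * M ^+ 2 = (2 * M) ^+ 2 by ring.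
  rewrite lerXn2r ?nnegrE//; first by have := M1; lra.
  by apply: normalized_residual_bound => //; exact: clip_cube.
have := B t; have := B u; rewrite ler_norml => /andP[? ?] /andP[? ?].
by apply/andP; split; lra.
Qed.

(** The population risk with clipped inputs: the integrand is bounded on the whole space, so this is
    a real number. *)
Definition smooth_risk theta : R := 2^-1 * \int[P]_t res theta t ^+ 2.

Definition sample_risk (S : n.-tuple (d.-tuple R)) theta : R :=
  (2 * n%:R)^-1 * \sum_(t <- S) res theta t ^+ 2.

Variables (delta lambda : R).
Hypothesis delta01 : 0 < delta < 1.
Hypothesis hlambda : 4 * M ^+ 2 *
  (2 + 14 * d%:R ^+ 2 * Num.sqrt (2 * ln (2 * d%:R))
     + Num.sqrt (2 * ln (2 / (3 * delta)))) <= lambda.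

Let sn : R := Num.sqrt n%:R.
Let r : R := Num.sqrt (2 * ln (2 * d%:R)).
Let tail := 4 * M ^+ 2 * sn * Num.sqrt (2 * ln (delta / 2)^-1).

Let delta2 : 0 < delta / 2 < 1.
Proof. by have /andP[? ?] := delta01; apply/andP; split; lra. Qed.

Let c0 : 0 < 4 * M ^+ 2.
Proof. by rewrite mulr_gt0// exprn_gt0//; exact: lt_le_trans M1. Qed.

Let d1 : (1 : R) <= d%:R. Proof. by rewrite ler1n. Qed.

Let r0 : 0 <= r. Proof. exact: sqrtr_ge0. Qed.

(** Source of the 2 / (3 delta): ln (2 / delta) = ln 3 + ln (2 / (3 delta)), and the square root of
    2 ln 3 is at most 3/2 r because ln 3 <= 2 ln 2 <= 2 ln (2 d). *)
Let tail_le : tail <= sn * (4 * M ^+ 2) * (3 / 2 * r + Num.sqrt (2 * ln (2 / (3 * delta)))).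
Proof.
have /andP[dl0 dl1] := delta01.
rewrite /tail [4 * M ^+ 2 * sn]mulrC ler_pM2l; last first.
  by rewrite mulr_gt0// /sn sqrtr_gt0 ltr0n.
have -> : ln (delta / 2)^-1 = ln 3 + ln (2 / (3 * delta)).
  rewrite -lnM ?posrE ?divr_gt0 ?mulr_gt0//; congr ln; field.
  by rewrite gt_eqF.
have l30 : 0 <= ln (3 : R) by rewrite ln_ge0//; lra.
rewrite mulrDr; apply: le_trans (sqrtrD_le _ _) _; first by rewrite mulr_ge0.
rewrite lerD2r -(ler_pXn2r (n := 2)) ?nnegrE ?mulr_ge0 ?sqrtr_ge0//.
have l2 : ln 2 <= ln (2 * d%:R : R).
  by rewrite ler_ln ?posrE//; have := d1; lra.
have l20 : 0 <= ln (2 : R) by rewrite ln_ge0//; lra.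
have l32 : ln 3 <= 2 * ln (2 : R).
  rewrite mulr_natl -lnXn// ler_ln ?posrE ?exprn_gt0//.
  by rewrite expr2; lra.
rewrite exprMn !sqr_sqrtr ?mulr_ge0//; last by lra.
by rewrite expr_div_n; lra.
Qed.

Let tail_lambda : tail <= sn * lambda.
Proof.
apply: le_trans tail_le _; rewrite -mulrA ler_wpM2l ?sqrtr_ge0//.
apply: (le_trans _ hlambda); rewrite ler_wpM2l ?(ltW c0)// lerD2r -/r.
have rd : r <= d%:R ^+ 2 * r by rewrite ler_peMl// expr2 mulr_ege1.
by have := r0; lra.
Qed.

(** Source of the 14: with 5 d^2 M^2 + M <= 6 d^2 M^2, symmetrization costs 12 d^2 r in units of 4
    M^2 sn, and [tail_le] adds 3/2 r <= 2 d^2 r. *)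
Let upper_lambda : 2 * (4 * M * ((5 * d%:R ^+ 2 * M + 1) * sn * r)) + tail <= sn * lambda.
Proof.
apply: (@le_trans _ _ (sn * (4 * M ^+ 2) * (12 * d%:R ^+ 2 * r) + tail)).
  rewrite lerD2r.
  have sr0 : 0 <= sn * r by rewrite mulr_ge0// sqrtr_ge0.
  rewrite (_ : 2 * _ = 8 * ((5 * d%:R ^+ 2 * M ^+ 2 + M) * (sn * r))); last by ring.
  rewrite (_ : sn * _ * _ = 8 * ((6 * d%:R ^+ 2 * M ^+ 2) * (sn * r))); last by ring.
  rewrite ler_pM2l// ler_wpM2r//.
  have dd : (1 : R) <= d%:R ^+ 2 by rewrite expr2 mulr_ege1.
  have M2 : M <= M ^+ 2 by rewrite expr2 ler_peMr//; exact: le_trans M1.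
  have : M ^+ 2 <= d%:R ^+ 2 * M ^+ 2 by rewrite ler_peMl// sqr_ge0.
  by lra.
apply: le_trans (lerD (lexx _) tail_le) _; rewrite -mulrDr -[leLHS]mulrA ler_wpM2l ?sqrtr_ge0//.
apply: (le_trans _ hlambda); rewrite ler_wpM2l ?(ltW c0)// addrA lerD2r -/r.
have rd : r <= d%:R ^+ 2 * r by rewrite ler_peMl// expr2 mulr_ege1.
by have := r0; lra.
Qed.

Let int_sq theta :
  \int[P]_t res theta t ^+ 2 = (path_norm theta + 1) ^+ 2 * \int[P]_t q theta t ^+ 2.
Proof.
rewrite -(Rintegral_scale P _ (bmf_sq (bmf_normalized_residual theta))).
apply: eq_Rintegral => t _; rewrite -exprMn mulrC /q /normalized_residual divfK//.
by rewrite gt_eqF// ltr_wpDl// path_norm_ge0.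
Qed.

Let sum_sq (S : n.-tuple (d.-tuple R)) theta :
  \sum_(t <- S) res theta t ^+ 2 =
  (path_norm theta + 1) ^+ 2 * \sum_(t <- S) q theta t ^+ 2.
Proof.
rewrite big_distrr /=; apply: eq_bigr => t _.
rewrite -exprMn mulrC /q /normalized_residual divfK//.
by rewrite gt_eqF// ltr_wpDl// path_norm_ge0.
Qed.

Let sum_dev (S : n.-tuple (d.-tuple R)) (g : d.-tuple R -> R) k :
  \sum_(t <- S) (g t - k) = \sum_(t <- S) g t - n%:R * k.
Proof. by rewrite sumrB big_const_seq iter_addr_0 count_predT size_tuple -[k *+ _]mulr_natl. Qed.

(** The upper bound is for a whole sequence, later an enumeration of the rational parameters. The
    reverse bound concerns only [th1], chosen independently of the sample. *)
Lemma network_deviation (th : nat -> params (R := R) (d := d) m) (th1 : params m) :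
  exists E : set (n.-tuple (d.-tuple R)),
    [/\ measurable E, ((1 - delta)%:E <= iid P n E)%E &
      forall S, E S ->
        [/\ forall i, cube (pt (tnth S i)),
            forall k, smooth_risk (th k) <= sample_risk S (th k)
              + lambda / sn * (2^-1 * (path_norm (th k) + 1) ^+ 2) &
            sample_risk S th1 <= smooth_risk th1
              + lambda / sn * (2^-1 * (path_norm th1 + 1) ^+ 2)]].
Proof.
have nR : (0 : R) < n%:R by rewrite ltr0n.
have sn0 : 0 < sn by rewrite sqrtr_gt0.
have sn2 : n%:R = sn * sn by rewrite -expr2 sqr_sqrtr// ltW.
pose V := 4 * M * ((5 * d%:R ^+ 2 * M + 1) * sn * r).
pose hU k t := - q (th k) t ^+ 2.
(* A constant sequence, so that the countable version also covers a single function. *)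
pose hL (_ : nat) t := q th1 t ^+ 2.
have bhU k : bmf (hU k) by exact: (bmfN (bmf_sq (bmf_normalized_residual (th k)))).
have bhL k : bmf (hL k) by exact: (bmf_sq (bmf_normalized_residual th1)).
have [||mU PU] := @countable_class_deviation _ _ _ P n (4 * M ^+
  2) (delta / 2) V n0 c0 delta2 hU bhU.
- move=> k t u; rewrite /hU (_ : - _ - - _ = - (q (th k) t ^+ 2 - q (th k) u ^+ 2)); last by ring.
  by rewrite normrN.
- move=> N s; have := @rademacher_squared_residual _ _ _ M A b c f M1 A_bnd b_bnd c_bnd f_bnd d0 m0
    _ clip s clip_cube _ ord0 (fun i : 'I_N.+1 => th i).
  by rewrite size_tuple.
have [||mL PL] := @countable_class_deviation _ _ _ P n (4 * M ^+
  2) (delta / 2) 0 n0 c0 delta2 hL bhL.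
- by move=> k t u; exact: sq_dev.
- move=> N s; rewrite -[leRHS](@avg_ssum R n _ s (fun t => q th1 t ^+ 2)).
  by apply: avg_le => e; apply: smax_le => i.
set U := [set S | _] in mU PU; set L := [set S | _] in mL PL.
pose C := [set S : n.-tuple (d.-tuple R) | forall i, cube (pt (tnth S i))].
have mC : measurable C.
  by apply: (measurable_box (A := fun _ : 'I_n => @pt R d @^-1` cube)) => i; exact: measurable_cube.
have [mE PE] := probability_avoid mC mU mL (iid_uniform_cube_cube d n) PU PL.
exists (C `&` ~` U `&` ~` L); split; [exact: mE|by rewrite [delta in X in (X <= _)%E]splitr|].
move=> S [[CS US] LS].
(* Undoes the normalization: multiplying by Q^2 / (2 n) turns [sn * lambda] into [lambda / sn] times
   Q^2 / 2, since n = sn^2. *)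
have key Q x y : n%:R * x - y <= sn * lambda ->
    2^-1 * (Q ^+ 2 * x) <= (2 * n%:R)^-1 * (Q ^+ 2 * y) + lambda / sn * (2^-1 * Q ^+ 2).
  move=> h; rewrite -subr_ge0.
  have -> : (2 * n%:R)^-1 * (Q ^+ 2 * y) + lambda / sn * (2^-1 * Q ^+ 2) - 2^-1 * (Q ^+ 2 * x)
     = Q ^+ 2 / (2 * n%:R) * (sn * lambda - (n%:R * x - y)).
    by rewrite sn2; field; rewrite gt_eqF.
  by rewrite mulr_ge0 ?subr_ge0// divr_ge0 ?sqr_ge0// mulr_ge0// ltW.
split=> [//|k|].
- rewrite /smooth_risk /sample_risk int_sq sum_sq; apply: key.
  move: US; rewrite /U /= => /forallNP/(_ k)/negP; rewrite -ltNge => /ltW.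
  rewrite sum_dev /hU => h.
  have E1 : \int[P]_t - q (th k) t ^+ 2 = - \int[P]_t q (th k) t ^+ 2.
    rewrite -[RHS]mulN1r -(Rintegral_scale P _ (bmf_sq (bmf_normalized_residual (th k)))).
    by apply: eq_Rintegral => t _; rewrite mulN1r.
  move: h; rewrite E1 sumrN mulrN opprK addrC => h.
  by apply: le_trans h _; exact: upper_lambda.
- rewrite /smooth_risk /sample_risk int_sq sum_sq.
  move: LS; rewrite /L /= => /forallNP/(_ 0)/negP; rewrite -ltNge => /ltW.
  rewrite sum_dev /hL mulr0 add0r => h.
  have := key (path_norm th1 + 1) (- \int[P]_t q th1 t ^+ 2) (- \sum_(t <- S) q th1 t ^+ 2).
  rewrite !mulrN opprK addrC => H.
  have {}H := H (le_trans h tail_lambda); lra.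
Qed.

End network_deviation.

(** * Approximation by finite networks *)

Section maurey.
Context {R : realType} {d1 d2 : measure_display}.
Context {T : measurableType d1} {Y : measurableType d2}.
Variables (P : probability T R) (rho : probability Y R).
Variables (F : T * Y -> R) (f : T -> R).
Hypothesis mF : measurable_fun setT F.
Hypothesis iF : forall t, rho.-integrable setT (fun y => (F (t, y))%:E).
Hypothesis fE : forall t, (f t)%:E = (\int[rho]_y (F (t, y))%:E)%E.

(** The positive and negative parts of [F] have measurable partial integrals by Tonelli, and [f] is
    their difference. This provides the measurability of the target function. *)
Lemma measurable_barycenter : measurable_fun setT f.
Proof.
apply/measurable_EFinP.
have mEF : measurable_fun setT (EFin \o F) by exact/measurable_EFinP.
rewrite (_ : _ \o _ = fun t => (fubini_F rho (EFin \o F)^\+ t - fubini_F rho (EFin \o F)^\- t)%E).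
  apply: emeasurable_funB; apply: measurable_fun_fubini_tonelli_F => //.
    exact: measurable_funepos.
  exact: measurable_funeneg.
apply/funext => t; rewrite /= fE [LHS]integralE /fubini_F; congr (_ - _)%E;
  apply: eq_integral => y _.
  by rewrite !funeposE.
by rewrite !funenegE.
Qed.

Variables (N : Y -> R) (L s : R).
Hypothesis mN : measurable_fun setT N.
Hypothesis L0 : 0 <= L.
Hypothesis FN : forall t y, `|F (t, y)| <= L * N y.
Hypothesis s0 : 0 < s.
Hypothesis N2 : (\int[rho]_y (N y ^+ 2)%:E <= (s ^+ 2)%:E)%E.

Let mN2 : measurable_fun setT (fun y => (N y ^+ 2)%:E).
Proof. by apply/measurable_EFinP; exact: measurable_funX. Qed.

Let mFt t : measurable_fun setT (fun y => F (t, y)).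
Proof. exact: measurableT_comp mF (measurable_pair1 t). Qed.

Let F2N t y : F (t, y) ^+ 2 <= L ^+ 2 * N y ^+ 2.
Proof.
rewrite -exprMn -[leLHS]ger0_norm ?sqr_ge0// normrX lerXn2r ?nnegrE//.
exact: le_trans (normr_ge0 _) (FN t y).
Qed.

Let iF2 t : rho.-integrable setT (fun y => (F (t, y) ^+ 2)%:E).
Proof.
have iN2 : rho.-integrable setT (fun y => (N y ^+ 2)%:E).
  apply/integrableP; split=> //.
  rewrite (eq_integral (fun y => (N y ^+ 2)%:E)).
    by apply: le_lt_trans N2 _; rewrite ltry.
  by move=> y _; rewrite gee0_abs// lee_fin sqr_ge0.
have iN : rho.-integrable setT (fun y => ((L ^+ 2)%:E * (N y ^+ 2)%:E)%E) by exact: integrableZl.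
apply: le_integrable iN => //.
  by apply/measurable_EFinP; exact: measurable_funX.
move=> y _; rewrite -EFinM /= lee_fin (ger0_norm (sqr_ge0 _)).
exact: le_trans (F2N t y) (ler_norm _).
Qed.

(** [F (t, y)] has mean [f t], so the cross term with [w] vanishes and the integral is w^2 - f^2
    plus the second moment of [F]. *)
Let second_moment t (w : R) :
  (\int[rho]_y ((w + F (t, y) - f t) ^+ 2)%:E <= (w ^+ 2 + L ^+ 2 * s ^+ 2)%:E)%E.
Proof.
pose k := w - f t.
have iC : rho.-integrable setT (fun y => (k ^+ 2)%:E).
  exact: (integrable_bmf rho (bmf_cst (k ^+ 2))).
have iL : rho.-integrable setT (fun y => ((2 * k)%:E * (F (t, y))%:E)%E) by exact: integrableZl.
have E : (\int[rho]_y ((w + F (t, y) - f t) ^+ 2)%:E =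
    (k ^+ 2)%:E + ((2 * k)%:E * (f t)%:E + \int[rho]_y (F (t, y) ^+ 2)%:E))%E.
  transitivity (\int[rho]_y ((k ^+ 2)%:E + ((2 * k)%:E * (F (t, y))%:E + (F (t, y) ^+ 2)%:E)))%E.
    by apply: eq_integral => y _; rewrite -EFinM -!EFinD /k; congr EFin; ring.
  rewrite integralD//; last exact: integrableD.
  rewrite integralD// integralZl// -fE; congr (_ + _)%E.
  rewrite -(EFin_Rintegral rho (bmf_cst (k ^+ 2))); congr EFin.
  exact: Rintegral_const.
have F2 : (\int[rho]_y (F (t, y) ^+ 2)%:E <= (L ^+ 2 * s ^+ 2)%:E)%E.
  apply: (@le_trans _ _ (\int[rho]_y ((L ^+ 2)%:E * (N y ^+ 2)%:E))%E).
    apply: ge0_le_integral => //.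
    - by move=> y _; rewrite lee_fin sqr_ge0.
    - by apply/measurable_EFinP; exact: measurable_funX.
    - by apply/measurable_EFinP; apply: measurable_funM => //; exact: measurable_funX.
    - by move=> y _; rewrite -EFinM lee_fin.
  rewrite ge0_integralZl_EFin ?sqr_ge0//; last by move=> y _; rewrite lee_fin sqr_ge0.
  by rewrite [leRHS]EFinM lee_wpmul2l// lee_fin sqr_ge0.
rewrite E; apply: (@le_trans _ _ ((k ^+ 2)%:E + ((2 * k)%:E * (f t)%:E + (L ^+ 2 * s ^+ 2)%:E))%E).
  by do 2 apply: leeD => //.
rewrite -EFinM -!EFinD lee_fin /k; have := sqr_ge0 (f t); nra.
Qed.

(** By the arithmetic-geometric inequality N <= (N^2 / s + s) / 2. Integrating this majorant plays
    the role of the Cauchy-Schwarz bound of the mean of [N] by [s]. *)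
Let meanN kappa : 0 <= kappa ->
  (\int[rho]_y (kappa * ((N y ^+ 2 / s + s) / 2))%:E <= (kappa * s)%:E)%E.
Proof.
move=> k0.
apply: (@le_trans _ _ (\int[rho]_y ((kappa / 2 / s)%:E * (N y ^+ 2)%:E + (kappa / 2 * s)%:E))%E).
  rewrite le_eqVlt; apply/orP; left; apply/eqP; apply: eq_integral => y _.
  by rewrite -EFinM -EFinD; congr EFin; field; rewrite gt_eqF.
have ks : 0 <= kappa / 2 / s by rewrite !divr_ge0// ltW.
rewrite ge0_integralD//.
- rewrite ge0_integralZl_EFin//; last by move=> y _; rewrite lee_fin sqr_ge0.
  rewrite -(EFin_Rintegral rho (bmf_cst (kappa / 2 * s))) Rintegral_const.
  apply: (@le_trans _ _ ((kappa / 2 / s)%:E * (s ^+ 2)%:E + (kappa / 2 * s)%:E)%E).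
    by rewrite leeD2r// lee_wpmul2l.
  rewrite -EFinM -EFinD lee_fin le_eqVlt; apply/orP; left; apply/eqP; field.
  by rewrite gt_eqF.
- by move=> y _; rewrite -EFinM lee_fin mulr_ge0 ?sqr_ge0.
- by apply: emeasurable_funM.
- by move=> y _; rewrite lee_fin !mulr_ge0// ltW.
Qed.

Hypothesis bf : bmf f.

Let bFy y : bmf (fun t => F (t, y)).
Proof.
split; first exact: measurableT_comp mF (measurable_pair2 y).
by exists (L * N y) => t.
Qed.

(** If every [y] failed, integrating over [rho] would contradict the bound on the mean; [eps] makes
    the contradiction strict. Adding [kappa * N y] to the error lets one choice of [y] control both
    the error and the path norm. *)
Lemma maurey_step W kappa eps : bmf W -> 0 <= kappa -> 0 < eps ->
  exists y, \int[P]_t (W t + F (t, y) - f t) ^+ 2 + kappa * N y <=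
    \int[P]_t W t ^+ 2 + (L ^+ 2 * s ^+ 2 + kappa * s + eps).
Proof.
move=> bW k0 e0; apply: contrapT => /forallNP H.
have bsq g : bmf g -> bmf (fun t : T => g t ^+ 2).
  by move=> bg; under eq_fun do rewrite expr2; exact: bmfM.
set G := \int[P]_t W t ^+ 2.
have bW2 : bmf (fun t => W t ^+ 2) by exact: bsq.
have bWF y : bmf (fun t => (W t + F (t, y) - f t) ^+ 2).
  by apply: bsq; apply: bmfB => //; exact: bmfD.
pose h (z : T * Y) : \bar R := ((W z.1 + F z - f z.1) ^+ 2)%:E.
have mh : measurable_fun setT h.
  apply/measurable_EFinP; apply: measurable_funX; apply: measurable_funB.
    apply: measurable_funD => //; apply: measurableT_comp measurable_fst.
    exact: (proj1 bW).
  by apply: measurableT_comp measurable_fst; exact: (proj1 bf).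
have h0 z : (0 <= h z)%E by rewrite lee_fin sqr_ge0.
have up : (\int[rho]_y (\int[P]_t h (t, y) + (kappa * ((N y ^+ 2 / s + s) / 2))%:E) <=
    (G + L ^+ 2 * s ^+ 2 + kappa * s)%:E)%E.
  rewrite ge0_integralD//; last 4 first.
  - by move=> y _; apply: integral_ge0.
  - exact: (measurable_fun_fubini_tonelli_G (m1 := P) h).
  - move=> y _; rewrite lee_fin mulr_ge0// divr_ge0// addr_ge0 ?(ltW s0)//.
    by rewrite divr_ge0 ?sqr_ge0// ltW.
  - apply/measurable_EFinP; apply: measurable_funM => //; apply: measurable_funM => //.
    by apply: measurable_funD => //; apply: measurable_funM => //; exact: measurable_funX.
  rewrite EFinD; apply: leeD; last exact: meanN.
  rewrite -(fubini_tonelli (m1 := P) (m2 := rho) h)//.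
  have bWL : bmf (fun t => W t ^+ 2 + L ^+ 2 * s ^+ 2) by apply: bmfD; [exact: bsq|exact: bmf_cst].
  apply: (@le_trans _ _ (\int[P]_t (W t ^+ 2 + L ^+ 2 * s ^+ 2)%:E)%E).
    apply: ge0_le_integral => //.
    - by move=> t _; apply: integral_ge0.
    - exact: (measurable_fun_fubini_tonelli_F (m2 := rho) h).
    - exact: measurable_bmf_EFin.
    - by move=> t _; exact: (second_moment t (W t)).
  rewrite -(EFin_Rintegral P bWL) (Rintegral_add P bW2 (bmf_cst (L ^+ 2 * s ^+ 2))).
  by rewrite Rintegral_const.
have low : ((G + L ^+ 2 * s ^+ 2 + kappa * s + eps)%:E <=
    \int[rho]_y (\int[P]_t h (t, y) + (kappa * ((N y ^+ 2 / s + s) / 2))%:E))%E.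
  rewrite -[X in (X%:E <= _)%E](Rintegral_const rho) (EFin_Rintegral rho (bmf_cst _)).
  apply: ge0_le_integral => //.
  - move=> y _; rewrite lee_fin !addr_ge0 ?mulr_ge0 ?sqr_ge0 ?(ltW s0) ?(ltW e0)//.
    by apply: Rintegral_ge0 => t _; exact: sqr_ge0.
  - apply: emeasurable_funD; first exact: (measurable_fun_fubini_tonelli_G (m1 := P) h).
    apply/measurable_EFinP; apply: measurable_funM => //; apply: measurable_funM => //.
    by apply: measurable_funD => //; apply: measurable_funM => //; exact: measurable_funX.
  - move=> y _; rewrite -(EFin_Rintegral P (bWF y)) -EFinD lee_fin.
    have /negP := H y; rewrite -ltNge => /ltW; rewrite -/G => Hy.
    have : kappa * N y <= kappa * ((N y ^+ 2 / s + s) / 2).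
      rewrite ler_wpM2l// -subr_ge0.
      have -> : (N y ^+ 2 / s + s) / 2 - N y = (N y - s) ^+ 2 / s / 2.
        by field; rewrite gt_eqF.
      by rewrite !divr_ge0 ?sqr_ge0// ltW.
    by move: Hy; lra.
by have := le_trans low up; rewrite lee_fin; lra.
Qed.

(* Maurey's argument, choosing the points one at a time instead of sampling from a
   product law. *)
Lemma maurey kappa eps k : 0 <= kappa -> 0 < eps ->
  exists ys : seq Y, size ys = k /\
    \int[P]_t (\sum_(y <- ys) (F (t, y) - f t)) ^+ 2 + kappa * \sum_(y <- ys) N y <=
    k%:R * (L ^+ 2 * s ^+ 2 + kappa * s + eps).
Proof.
move=> k0 e0; elim: k => [|k [ys [sz IH]]].
  exists [::]; split=> //; rewrite big_nil mulr0 mul0r addr0.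
  rewrite (eq_Rintegral _ (g := fun _ : T => 0)); last first.
    by move=> t _; rewrite big_nil expr0n.
  by rewrite Rintegral_const.
pose W t := \sum_(y <- ys) (F (t, y) - f t).
have bW : bmf W by apply: bmf_sum => y; exact: bmfB.
have [y Hy] := maurey_step bW k0 e0.
exists (y :: ys); split; first by rewrite /= sz.
rewrite big_cons (eq_Rintegral _ (g := fun t => (W t + F (t, y) - f t) ^+ 2)); last first.
  by move=> t _; rewrite big_cons /W addrC addrA.
rewrite -natr1; move: IH Hy; rewrite -/W; move: (\sum_(y0 <- ys) N y0) => SN.
by nra.
Qed.

(** Serves the case of norm zero: [s] can then be taken arbitrarily small, which forces [f] to
    vanish. *)
Lemma barycenter_le t : `|f t| <= L * s.
Proof.
have iN : (\int[rho]_y (1 * ((N y ^+ 2 / s + s) / 2))%:E <= (1 * s)%:E)%E by exact: meanN.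
have Nle y : N y <= (N y ^+ 2 / s + s) / 2.
  rewrite -subr_ge0 (_ : _ - _ = (N y - s) ^+ 2 / s / 2).
    by rewrite !divr_ge0 ?sqr_ge0// ltW.
  by field; rewrite gt_eqF.
rewrite -lee_fin EFinM -[(`|f t|)%:E]/(`|(f t)%:E|)%E fE.
apply: le_trans (le_abse_integral _ _ _) _ => //.
  exact/measurable_EFinP.
apply: (@le_trans _ _ (\int[rho]_y (L%:E * ((N y ^+ 2 / s + s) / 2)%:E))%E).
  apply: ge0_le_integral => //.
  - by apply: measurableT_comp => //; exact/measurable_EFinP.
  - apply: emeasurable_funM => //; apply/measurable_EFinP; apply: measurable_funM => //.
    by apply: measurable_funD => //; apply: measurable_funM => //; exact: measurable_funX.
  - move=> y _; rewrite -EFinM lee_fin; apply: le_trans (FN t y) _.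
    by rewrite ler_wpM2l.
rewrite ge0_integralZl_EFin//; last 2 first.
- by move=> y _; rewrite lee_fin divr_ge0// addr_ge0 ?(ltW s0)// divr_ge0 ?sqr_ge0// ltW.
- apply/measurable_EFinP; apply: measurable_funM => //.
  by apply: measurable_funD => //; apply: measurable_funM => //; exact: measurable_funX.
rewrite lee_wpmul2l//; move: iN; rewrite mul1r; apply: le_trans.
by rewrite le_eqVlt; apply/orP; left; apply/eqP; apply: eq_integral => y _; rewrite mul1r.
Qed.

End maurey.

(** * The differential operator applied to a network *)

Section activation_derivatives.
Context {R : realType}.

(** A remainder bound valid for all [h] handles the junction at 0 and the smooth points alike. *)
Lemma is_derive_quadratic_remainder (g : R -> R) (z l K : R) :
  (forall h, `|g (h + z) - g z - h * l| <= K * h ^+ 2) -> is_derive z (1 : R) g l.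
Proof.
move=> gl.
have cv : (fun h => h^-1 *: ((g \o shift z) (h *: 1) - g z)) @ 0^' --> l.
  apply/cvgrPdist_le => e e0; near=> h.
  have h0 : h != 0 by near: h; exact: nbhs_dnbhs_neq.
  rewrite distrC /= [h *: 1]mulr1.
  have -> : h^-1 *: (g (h + z) - g z) - l = h^-1 * (g (h + z) - g z - h * l).
    by rewrite /GRing.scale/=; field.
  rewrite normrM normfV ler_pdivrMl ?normr_gt0//.
  apply: le_trans (gl h) _; rewrite -[h ^+ 2]ger0_norm ?sqr_ge0// normrX expr2 mulrCA.
  rewrite ler_wpM2l//.
  apply: (@le_trans _ _ ((`|K| + 1) * `|h|)).
    by rewrite ler_wpM2r//; apply: le_trans (ler_norm _) _; rewrite lerDl.
  rewrite -ler_pdivlMl ?ltr_wpDl// mulrC.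
  near: h; apply: dnbhs0_le; rewrite divr_gt0 ?ltr_wpDl//.
have dg : derivable g z 1 by apply/cvg_ex; exists l.
by apply: DeriveDef => //; apply/cvg_lim.
Unshelve. all: by end_near. Qed.

(** The one derivative computed by hand: [act1] is a multiple of [act2 ^+ 2], and [act] a multiple
    of z times it. [act2] itself has a kink at 0. *)
Lemma is_derive_act2_sqr (z : R) : is_derive z (1 : R) (fun y => act2 y ^+ 2) (2 * act2 z).
Proof.
apply: (@is_derive_quadratic_remainder _ _ _ 1) => h; rewrite mul1r /act2.
have [hz|hz] := leP (h + z) 0; have [z0|z0] := leP z 0; rewrite ler_norml; apply/andP; split; nra.
Qed.

Lemma act_act2 (z : R) : act z = 6^-1 * (z * act2 z ^+ 2).
Proof.
rewrite actE /act2; have [z0|z0] := leP z 0; first by rewrite !expr0n/= !mulr0.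
by rewrite exprS.
Qed.

Lemma is_derive_act (z : R) : is_derive z (1 : R) act (act1 z).
Proof.
have -> : (act : R -> R) = (fun y => 6^-1 * (y * act2 y ^+ 2)).
  by apply/funext => y; exact: act_act2.
have H := is_derive_act2_sqr z.
apply: is_derive_eq; rewrite /GRing.scale/= /act1 -/(act2 z).
have : z * act2 z = act2 z ^+ 2.
  rewrite /act2; have [z0|z0] := leP z 0; first by rewrite expr0n/= mulr0.
  by rewrite expr2.
by lra.
Qed.

Lemma is_derive_act1 (z : R) : is_derive z (1 : R) act1 (act2 z).
Proof.
have H := is_derive_act2_sqr z.
have -> : (act1 : R -> R) = (fun y => 2^-1 * act2 y ^+ 2) by [].
by apply: is_derive_eq; rewrite /GRing.scale/=; field.
Qed.

End activation_derivatives.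

Section ridge_derivatives.
Context {R : realType} {d m : nat}.
Implicit Types (x : 'rV[R]_d).

(** Along a coordinate line the chain rule is one-dimensional. The profile [g] is general because
    the lemma is used twice: with [act], and with [act1] for the second derivatives. *)
Lemma partial_ridge_sum (al : 'I_m -> R) (w : 'I_m -> 'rV[R]_d) (g g' : R -> R) i x :
  (forall z, is_derive z (1 : R) g (g' z)) ->
  partial i (fun y => \sum_k al k * g (dotr (w k) y)) x =
  \sum_k al k * w k 0 i * g' (dotr (w k) x).
Proof.
move=> dg; set u := fun y => _.
pose phi (h : R) := u (h *: delta_mx 0 i + x).
have phiE : phi = \sum_k (fun h => al k * g (h * w k 0 i + dotr (w k) x)).
  apply/funext => h; rewrite fct_sumE; apply: eq_bigr => k _; congr (_ * g _).
  rewrite /dotr (bigD1 i)//= [in RHS](bigD1 i)//= !mxE !eqxx mulr1 addrA; congr (_ + _).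
    by ring.
  by apply: eq_bigr => j ji; rewrite !mxE (negbTE ji) andbF mulr0 add0r.
have dphi : is_derive (0 : R) (1 : R) phi (\sum_k al k * w k 0 i * g' (dotr (w k) x)).
  rewrite phiE; apply: is_derive_sum => k.
  have dg' := dg (0 * w k 0 i + dotr (w k) x).
  have dl : is_derive (0 : R) (1 : R) (fun h => h * w k 0 i + dotr (w k) x) (w k 0 i).
    by apply: is_derive_eq; rewrite /GRing.scale/=; ring.
  have H := is_deriveZ (al k) (is_derive1_comp (f := g)
    (g := fun h => h * w k 0 i + dotr (w k) x) (x := 0) dg' dl).
  by apply: (is_derive_eq H); rewrite /GRing.scale/= mul0r add0r; ring.
transitivity ('D_1 phi 0); last by have [_ ->] := dphi.
have E : (fun h : R => h^-1 *: ((u \o shift x) (h *: delta_mx 0 i) - u x)) =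
    (fun h : R => h^-1 *: ((phi \o shift 0) (h *: (1 : R)) - phi 0)).
  by apply/funext => h; rewrite /phi /= !addr0 scale0r add0r [h *: 1]mulr1.
by rewrite /partial /derive E.
Qed.

(** Holds at every point, kinks included, since [act] is twice differentiable everywhere. *)
Lemma diffop_network A b c (theta : params (R := R) (d := d) m) x :
  diffop A b c (network theta) x = pde_network A b c theta x.
Proof.
pose w k := row k theta.2.
have d1 i : partial i (network theta) =
    (fun y => \sum_k (theta.1 0 k * w k 0 i) * act1 (dotr (w k) y)).
  by apply/funext => y; apply: partial_ridge_sum; exact: is_derive_act.
have d2 i j : partial j (partial i (network theta)) x =
    \sum_k theta.1 0 k * w k 0 i * w k 0 j * act2 (dotr (w k) x).
  by rewrite d1; apply: partial_ridge_sum; exact: is_derive_act1.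
rewrite /diffop /pde_network.
under [RHS]eq_bigr do rewrite featureE !mulrDr.
rewrite !big_split /=; congr (_ + _ + _).
- under eq_bigr do under eq_bigr do rewrite d2 big_distrr /=.
  under eq_bigr do rewrite exchange_big /=.
  rewrite exchange_big /=; apply: eq_bigr => k _; rewrite big_distrr /=.
  apply: eq_bigr => i _; rewrite big_distrr /=; apply: eq_bigr => j _.
  by rewrite -/(w k); ring.
- under eq_bigr do rewrite d1 big_distrr /=.
  rewrite exchange_big /=; apply: eq_bigr => k _; rewrite big_distrr /=.
  by apply: eq_bigr => i _; rewrite -/(w k); ring.
- rewrite big_distrr /=; apply: eq_bigr => k _; ring.
Qed.

End ridge_derivatives.

(** * Density of rational parameters *)

Section limits.
Context {R : realType}.
Implicit Types (u v : nat -> R) (l : R).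

Lemma cvg_sumr (I : Type) (r : seq I) (u : I -> nat -> R) (l : I -> R) :
  (forall i, u i n @[n --> \oo] --> l i) ->
  (\sum_(i <- r) u i n) @[n --> \oo] --> \sum_(i <- r) l i.
Proof.
move=> ul; elim: r => [|i r IH].
  by rewrite big_nil; under eq_fun do rewrite big_nil; exact: cvg_cst.
by rewrite big_cons; under eq_fun do rewrite big_cons; exact: cvgD.
Qed.

Lemma cvg_exprn u l k : u n @[n --> \oo] --> l -> u n ^+ k @[n --> \oo] --> l ^+ k.
Proof.
move=> ul; elim: k => [|k IH]; first exact: cvg_cst.
by rewrite exprS; under eq_fun do rewrite exprS; exact: cvgM.
Qed.

Lemma cvg_act2 u l : u n @[n --> \oo] --> l -> act2 (u n) @[n --> \oo] --> act2 l.
Proof.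
move=> /cvgrPdist_le ul; apply/cvgrPdist_le => e e0.
by apply: filterS (ul e e0) => n; apply: le_trans; exact: act2_lip.
Qed.

Lemma cvg_act1 u l : u n @[n --> \oo] --> l -> act1 (u n) @[n --> \oo] --> act1 l.
Proof.
by move=> /cvg_act2 /(@cvg_exprn _ _ 2); apply: cvgM; exact: cvg_cst.
Qed.

Lemma cvg_act u l : u n @[n --> \oo] --> l -> act (u n) @[n --> \oo] --> act l.
Proof.
move=> ul; rewrite act_act2; under eq_fun do rewrite act_act2.
apply: cvgM; first exact: cvg_cst.
apply: cvgM => //; apply: cvg_exprn; exact: cvg_act2.
Qed.

End limits.

Section parameter_limits.
Context {R : realType} {d m : nat}.
Variables (A : 'rV[R]_d -> 'M[R]_d) (b : 'rV[R]_d -> 'rV[R]_d) (c f : 'rV[R]_d -> R).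
Variables (Th : nat -> params (R := R) (d := d) m) (theta : params (R := R) (d := d) m).
Hypothesis cvga : forall k, (Th n).1 0 k @[n --> \oo] --> theta.1 0 k.
Hypothesis cvgw : forall k i, (Th n).2 k i @[n --> \oo] --> theta.2 k i.

Let cvg_row k i : row k (Th n).2 0 i @[n --> \oo] --> row k theta.2 0 i.
Proof. by rewrite mxE; under eq_fun do rewrite mxE; exact: cvgw. Qed.

Let cvg_dotr k x : dotr (row k (Th n).2) x @[n --> \oo] --> dotr (row k theta.2) x.
Proof. by apply: cvg_sumr => i; apply: cvgM => //; exact: cvg_cst. Qed.

Lemma cvg_pde_network x :
  pde_network A b c (Th n) x @[n --> \oo] --> pde_network A b c theta x.
Proof.
apply: cvg_sumr => k; apply: cvgM => //.
rewrite featureE; under eq_fun do rewrite featureE.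
apply: cvgD; last by apply: cvgM; [exact: cvg_cst|exact: cvg_act].
apply: cvgD; apply: cvg_sumr => i.
  apply: cvg_sumr => j; apply: cvgM; first exact: cvgM.
  by apply: cvgM; [exact: cvg_cst|exact: cvg_act2].
by apply: cvgM => //; apply: cvgM; [exact: cvg_cst|exact: cvg_act1].
Qed.

Lemma cvg_path_norm : path_norm (Th n) @[n --> \oo] --> path_norm theta.
Proof.
apply: cvg_sumr => k; apply: cvgM; first exact: cvg_norm.
by apply: cvg_exprn; apply: cvg_sumr => i; exact: cvg_norm.
Qed.

Lemma cvg_residual x :
  residual A b c f (Th n) x @[n --> \oo] --> residual A b c f theta x.
Proof. by apply: cvgB; [exact: cvg_pde_network|exact: cvg_cst]. Qed.

End parameter_limits.

Section density.
Context {R : realType} {d m : nat}.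

Lemma rat_approx (x : R) (n : nat) : exists q : rat, `|x - ratr q| <= n.+1%:R^-1.
Proof.
have : (0 : R) < n.+1%:R^-1 by rewrite invr_gt0.
move: n.+1%:R^-1 => e e0.
have [|q] := @rat_in_itvoo R (x - e) (x + e); first by lra.
rewrite in_itv/= => /andP[q1 q2]; exists q.
by rewrite ler_norml; apply/andP; split; lra.
Qed.

(** An enumeration by codes; indices that decode to nothing yield the zero network. *)
Definition rational_params (k : nat) : params (R := R) (d := d) m :=
  if (unpickle k : option ('rV[rat]_m * 'M[rat]_(m, d))%type) is Some p
  then (map_mx ratr p.1, map_mx ratr p.2) else (0, 0).

Lemma rational_params_dense (theta : params (R := R) (d := d) m) :
  exists j : nat -> nat,
    (forall k, (rational_params (j n)).1 0 k @[n --> \oo] --> theta.1 0 k) /\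
    (forall k i, (rational_params (j n)).2 k i @[n --> \oo] --> theta.2 k i).
Proof.
pose q x n := projT1 (cid (rat_approx x n)).
have qP x n : `|x - ratr (q x n)| <= n.+1%:R^-1 by rewrite /q; case: cid.
have cvgq x : ratr (q x n) @[n --> \oo] --> x.
  apply/cvgrPdist_le => e e0.
  have /cvgrPdist_le/(_ e e0) := @cvg_harmonic R.
  apply: filterS => n; apply: le_trans; rewrite /harmonic sub0r normrN.
  by apply: le_trans (qP x n) (ler_norm _).
pose p n : ('rV[rat]_m * 'M[rat]_(m, d))%type :=
  (\row_k q (theta.1 0 k) n, \matrix_(k, i) q (theta.2 k i) n).
exists (fun n => pickle (p n)).
split=> [k|k i].
  rewrite (_ : (fun n => _) = (fun n => ratr (q (theta.1 0 k) n))); first exact: cvgq.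
  by apply/funext => n; rewrite /rational_params pickleK /= !mxE.
rewrite (_ : (fun n => _) = (fun n => ratr (q (theta.2 k i) n))); first exact: cvgq.
by apply/funext => n; rewrite /rational_params pickleK /= !mxE.
Qed.

End density.

(** * Generalization bound *)

(** From exp (-1/10) >= 9/10 one gets exp (1/10) <= 10/9, and the sixth power of 10/9 is below 2. *)
Lemma ln2_ge {R : realType} : 3 / 5 <= ln (2 : R).
Proof.
have e1 : expR (10^-1 : R) <= 10 / 9.
  have he := expR_ge1Dx (- 10^-1 : R).
  have : 9 / 10 <= (expR (10^-1 : R))^-1 by rewrite -expRN; move: he; lra.
  have x0 := expR_gt0 (10^-1 : R).
  by rewrite -(ler_pM2r x0) mulVf ?gt_eqF//; lra.
rewrite -[leLHS]expRK ler_ln ?posrE ?expR_gt0//.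
have -> : (3 / 5 : R) = 6%:R * 10^-1 by field.
rewrite expRM_natl; apply: (@le_trans _ _ ((10 / 9) ^+ 6)).
  by rewrite lerXn2r ?nnegrE ?expR_ge0//; lra.
by rewrite !exprS expr0; lra.
Qed.

Section generalization.
Context {R : realType} {d m n : nat}.
Variables (M : R) (A : 'rV[R]_d -> 'M[R]_d) (b : 'rV[R]_d -> 'rV[R]_d).
Variables (c f : 'rV[R]_d -> R).
Hypothesis M1 : 1 <= M.
Hypothesis mA : forall i j,
  measurable_fun (pt @^-1` cube) (fun t : d.-tuple R => A (pt t) i j).
Hypothesis mb : forall i,
  measurable_fun (pt @^-1` cube) (fun t : d.-tuple R => b (pt t) 0 i).
Hypothesis mc : measurable_fun (pt @^-1` cube) (fun t : d.-tuple R => c (pt t)).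
Hypothesis A_bnd : forall x, cube x -> forall i j, `|A x i j| <= M.
Hypothesis b_bnd : forall x, cube x -> forall i, `|b x 0 i| <= M.
Hypothesis c_bnd : forall x, cube x -> `|c x| <= M.
Hypothesis f_bnd : forall x, cube x -> `|f x| <= 1.
Hypothesis m0 : (0 < m)%N.
Implicit Types (theta : params (R := R) (d := d) m).

Let M0 : 0 <= M. Proof. exact: le_trans M1. Qed.

Section barron.
Hypothesis f_barron : (barron_norm A b c f < +oo)%E.

Let B := fine (barron_norm A b c f).

Lemma barron_norm_ge0 : (0 <= barron_norm A b c f)%E.
Proof. by apply: le_ereal_inf_tmp => _ [rho _ <-]; exact: sqrte_ge0. Qed.

Lemma fine_barron_norm_ge0 : 0 <= B.
Proof. exact/fine_ge0/barron_norm_ge0. Qed.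

(** The infimum need not be attained, so a law is available only for [s] strictly above it. *)
Lemma barron_representation s : B < s ->
  exists2 rho : probability (R * d.-tuple R)%type R, represents A b c f rho &
    (\int[rho]_p ((`|p.1| * l1norm (pt p.2) ^+ 3) ^+ 2)%:E <= (s ^+ 2)%:E)%E.
Proof.
move=> Bs; have s0 : 0 <= s by exact: le_trans fine_barron_norm_ge0 (ltW Bs).
have : (barron_norm A b c f < s%:E)%E.
  rewrite -[barron_norm _ _ _ _]fineK ?lte_fin// ge0_fin_numE//.
  exact: barron_norm_ge0.
move=> /ereal_inf_lt[_ [rho repr <-]] Is; exists rho => //.
under eq_integral do rewrite exprMn -exprM.
move: Is; set I := (\int[rho]_p _)%E => Is.
have I0 : (0 <= I)%E.
  by apply: integral_ge0 => p _; rewrite lee_fin mulr_ge0 ?exprn_ge0// l1norm_ge0.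
move: I I0 Is => [x| |]//=; rewrite !lee_fin lte_fin => x0 xs.
by rewrite -(sqr_sqrtr x0) lerXn2r ?nnegrE ?sqrtr_ge0// ltW.
Qed.

Let Y : measurableType _ := (R * d.-tuple R)%type.
Let F (z : d.-tuple R * Y) : R := z.2.1 * feature A b c (pt z.2.2) (clip z.1).
Let N (p : Y) : R := `|p.1| * l1norm (pt p.2) ^+ 3.

Let measurable_pt dU (U : measurableType dU) (X : U -> d.-tuple R) i :
  measurable_fun setT X -> measurable_fun setT (fun u => pt (X u) 0 i).
Proof.
move=> mX; rewrite (_ : (fun u => _) = (fun u => tnth (X u) i)).
  exact: (measurableT_comp (measurable_tnth i) mX).
by apply/funext => u; rewrite mxE.
Qed.

Let mF : measurable_fun setT F.
Proof.
apply: measurable_funM.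
  exact: (measurableT_comp measurable_fst measurable_snd).
apply: (measurable_clip_feature mA mb mc (W := fun z : d.-tuple R * Y => pt z.2.2)) => // i.
apply: measurable_pt; exact: (measurableT_comp measurable_snd measurable_snd).
Qed.

Let mN : measurable_fun setT N.
Proof.
apply: measurable_funM; first exact: measurableT_comp.
apply: measurable_funX; apply: measurable_sum => i.
by apply: measurableT_comp => //; apply: measurable_pt.
Qed.

Let FN t y : `|F (t, y)| <= 2 * M * N y.
Proof.
rewrite /F /N normrM mulrCA ler_wpM2l//.
by apply: feature_bound => //; exact: clip_cube.
Qed.

Let M20 : 0 <= 2 * M. Proof. by rewrite mulr_ge0. Qed.

Lemma measurable_barron : measurable_fun setT (fun t => f (clip t)).
Proof.
have [|rho rep _] := @barron_representation (B + 1); first by rewrite ltrDl.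
apply: (measurable_barycenter (rho := rho) mF) => t.
exact: (rep _ (clip_cube t)).2.
Qed.

Let bf : bmf (fun t => f (clip t)).
Proof.
split; first exact: measurable_barron.
by exists 1 => t; apply: f_bnd; exact: clip_cube.
Qed.

(** Here a multiple of [B] leaves no room above the infimum; instead [barycenter_le] is applied with
    every s > 0. *)
Let barron_eq0 : B = 0 -> forall t, f (clip t) = 0.
Proof.
move=> B0 t; apply/eqP; rewrite -normr_le0; apply/ler_addgt0Pl => e e0; rewrite addr0.
have s0 : 0 < e / (2 * M) by rewrite divr_gt0// mulr_gt0//; exact: lt_le_trans M1.
have [|rho rep N2] := @barron_representation (e / (2 * M)); first by rewrite B0.
have := barycenter_le mF (fun t => (rep _ (clip_cube t)).2) mN M20 FN s0 N2 t.
by rewrite mulrC divfK// gt_eqF// mulr_gt0//; exact: lt_le_trans M1.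
Qed.

(** Maurey's inequality divided by [m] reads 2 m r + kappa q <= 12 M^2 B^2 for the risk r and the
    path norm q. Both terms are nonnegative, so each is at most the right-hand side. *)
Lemma barron_approximation : exists theta,
  smooth_risk A b c f theta <= 6 * M ^+ 2 * B ^+ 2 / m%:R /\ path_norm theta <= 2 * B.
Proof.
have mR : (0 : R) < m%:R by rewrite ltr0n.
have := fine_barron_norm_ge0; rewrite -/B le_eqVlt => /predU1P[B0|B0].
  exists (0, 0); split.
    rewrite /smooth_risk (eq_Rintegral _ (g := fun _ => 0)); last first.
      move=> t _; rewrite /residual barron_eq0// /pde_network big1 ?subr0 ?expr0n//.
      by move=> k _; rewrite mxE mul0r.
    by rewrite Rintegral_const mulr0 -/B -B0 expr0n mulr0 mul0r.
  rewrite -/B -B0 mulr0 /path_norm big1// => k _.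
  by rewrite mxE normr0 mul0r.
have M20' : 0 < M ^+ 2 by rewrite exprn_gt0//; exact: lt_le_trans M1.
pose s := 21 / 20 * B.
have Bs : B < s by rewrite /s; lra.
have s0 : 0 < s by exact: lt_trans Bs.
have [rho rep N2] := barron_representation Bs.
(* This [kappa] makes the same bound 12 M^2 B^2 mean q <= 2 B. In units of M^2 B^2 the total is 4
   (21/20)^2 + 6 (21/20) + 1 = 11.71, below 12. *)
pose kappa := 6 * M ^+ 2 * B; pose eps := M ^+ 2 * B ^+ 2.
have kappa0 : 0 < kappa by rewrite /kappa mulr_gt0// mulr_gt0.
have eps0 : 0 < eps by rewrite mulr_gt0// exprn_gt0.
have [ys [sz H]] := maurey (@uniform_cube R d) mF (fun t => (rep _ (clip_cube t)).1)
  (fun t => (rep _ (clip_cube t)).2) mN M20 FN s0 N2 bf m (ltW kappa0) eps0.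
pose y0 : Y := (0, [tuple 0 | i < d]).
(* Equal weights 1/m on the selected points, so that m times the residual is the sum of the
   deviations. *)
pose theta : params (R := R) (d := d) m :=
  (\row_k (m%:R^-1 * (nth y0 ys k).1), \matrix_k pt (nth y0 ys k).2).
have Q : m%:R * path_norm theta = \sum_(y <- ys) N y.
  rewrite (big_nth y0) big_mkord sz /path_norm big_distrr /=; apply: eq_bigr => k _.
  by rewrite rowK mxE normrM gtr0_norm ?invr_gt0// -mulrA mulVKf// gt_eqF.
have Rr t : m%:R * residual A b c f theta (clip t) = \sum_(y <- ys) (F (t, y) - f (clip t)).
  rewrite sumrB big_const_seq iter_addr_0 count_predT sz -[f (clip t) *+ m]mulr_natl.
  rewrite /residual mulrBr; congr (_ - _).
  rewrite (big_nth y0) big_mkord sz /pde_network big_distrr /=; apply: eq_bigr => k _.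
  by rewrite rowK mxE -mulrA mulVKf// gt_eqF.
have br : bmf (fun t => residual A b c f theta (clip t) ^+ 2).
  have := bmf_residual M1 mA mb mc measurable_barron A_bnd b_bnd c_bnd f_bnd theta.
  by move=> h; under eq_fun do rewrite expr2; exact: bmfM.
have I2 : \int[uniform_cube]_t (\sum_(y <- ys) (F (t, y) - f (clip t))) ^+ 2 =
    m%:R ^+ 2 * (2 * smooth_risk A b c f theta).
  rewrite /smooth_risk mulVKf// -(Rintegral_scale _ _ br).
  by apply: eq_Rintegral => t _; rewrite -exprMn Rr.
exists theta.
have r0 : 0 <= smooth_risk A b c f theta.
  by rewrite /smooth_risk mulr_ge0//; apply: Rintegral_ge0 => t _; exact: sqr_ge0.
have q0 := path_norm_ge0 theta.
move: H; rewrite I2 -Q.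
set r := smooth_risk _ _ _ _ _ in r0 *; set q := path_norm theta in q0 *.
rewrite (_ : m%:R ^+ 2 * (2 * r) + kappa * (m%:R * q) = m%:R * (2 * (m%:R * r) + kappa * q));
  last by ring.
rewrite ler_pM2l// => H.
have {}H : 2 * (m%:R * r) + kappa * q <= 12 * (M ^+ 2 * B ^+ 2).
  apply: le_trans H _; rewrite /s /kappa /eps.
  rewrite (_ : _ + _ + _ = (1171 / 100) * (M ^+ 2 * B ^+ 2)); last by field.
  by rewrite ler_pM2r// ?mulr_gt0 ?exprn_gt0//; lra.
have kq : 0 <= kappa * q by rewrite mulr_ge0// ltW.
have mr : 0 <= m%:R * r by rewrite mulr_ge0.
split.
  by rewrite ler_pdivlMr// mulrC -mulrA; lra.
rewrite -(ler_pM2l kappa0) (_ : kappa * (2 * B) = 12 * (M ^+ 2 * B ^+ 2));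
  last by rewrite /kappa; ring.
by lra.
Qed.

End barron.

Hypothesis mf : measurable_fun setT (fun t : d.-tuple R => f (clip t)).

Lemma population_risk_le theta :
  (population_risk A b c f theta <= (smooth_risk A b c f theta)%:E)%E.
Proof.
have br : bmf (fun t => 2^-1 * residual A b c f theta (clip t) ^+ 2).
  apply: bmfZ; have h := bmf_residual M1 mA mb mc mf A_bnd b_bnd c_bnd f_bnd theta.
  by under eq_fun do rewrite expr2; exact: bmfM.
have br2 : bmf (fun t => residual A b c f theta (clip t) ^+ 2).
  have h := bmf_residual M1 mA mb mc mf A_bnd b_bnd c_bnd f_bnd theta.
  by under eq_fun do rewrite expr2; exact: bmfM.
rewrite /smooth_risk -(Rintegral_scale _ _ br2) (EFin_Rintegral _ br).
apply: (@le_trans _ _ (\int[uniform_cube]_(t in pt @^-1` cube)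
    (2^-1 * residual A b c f theta (clip t) ^+ 2)%:E)%E).
  rewrite le_eqVlt; apply/orP; left; apply/eqP; apply: eq_integral => t; rewrite inE => ct.
  by rewrite diffop_network clipE.
apply: ge0_subset_integral => //; first exact: measurable_cube.
- exact: measurable_bmf_EFin.
- by move=> t _; rewrite lee_fin mulr_ge0 ?sqr_ge0.
Qed.

Lemma empirical_risk_clip (S : n.-tuple (d.-tuple R)) theta :
  (forall i, cube (pt (tnth S i))) ->
  empirical_risk A b c f S theta = sample_risk A b c f S theta.
Proof.
move=> cS; rewrite /empirical_risk /sample_risk big_tuple; congr (_ * _).
by apply: eq_bigr => i _; rewrite diffop_network clipE.
Qed.

(** Convergent parameters have bounded path norms, so the residuals share one constant bound and
    dominated convergence applies. *)
Lemma smooth_risk_cvg (Th : nat -> params m) theta :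
  (forall k, (Th j).1 0 k @[j --> \oo] --> theta.1 0 k) ->
  (forall k i, (Th j).2 k i @[j --> \oo] --> theta.2 k i) ->
  smooth_risk A b c f (Th j) @[j --> \oo] --> smooth_risk A b c f theta.
Proof.
move=> ca cw.
have bsq (th : params (R := R) (d := d) m) : bmf (fun t => residual A b c f th (clip t) ^+ 2).
  have h := bmf_residual M1 mA mb mc mf A_bnd b_bnd c_bnd f_bnd th.
  by under eq_fun do rewrite expr2; exact: bmfM.
apply: cvgM; first exact: cvg_cst.
have [K KQ] : exists K, forall j, path_norm (Th j) <= K.
  have : cvgn (fun j => path_norm (Th j)) by apply/cvg_ex; eexists; exact: cvg_path_norm ca cw.
  move=> /cvg_seq_bounded[K [_ KQ]]; exists (K + 1) => j.
  apply: le_trans (ler_norm _) _; apply: (KQ (K + 1)) => //.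
  by rewrite ltrDl.
have ig : (@uniform_cube R d).-integrable setT
    (fun _ : d.-tuple R => ((2 * M * (K + 1)) ^+ 2)%:E).
  exact: (integrable_bmf _ (bmf_cst ((2 * M * (K + 1)) ^+ 2))).
have [| | | |_ _ H] := @dominated_convergence _ _ _ (@uniform_cube R d) setT measurableT
  (fun j t => (residual A b c f (Th j) (clip t) ^+ 2)%:E)
  (fun t => (residual A b c f theta (clip t) ^+ 2)%:E)
  (fun _ => ((2 * M * (K + 1)) ^+ 2)%:E) _ _ _ ig.
- by move=> j; exact: measurable_bmf_EFin.
- exact: measurable_bmf_EFin.
- apply: aeW => t _; apply: cvg_EFin; first exact: nearW.
  by apply: cvg_exprn; exact: cvg_residual.
- apply: aeW => t j _; rewrite /= lee_fin normrX lerXn2r ?nnegrE ?mulr_ge0//.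
    by rewrite addr_ge0// (le_trans (path_norm_ge0 (Th 0%N)) (KQ 0%N)).
  apply: le_trans (residual_bound M1 A_bnd b_bnd c_bnd f_bnd (Th j) (clip_cube t)) _.
  by rewrite ler_wpM2l ?mulr_ge0// lerD2r.
apply: fine_cvg; rewrite -/(Rintegral _ _ _).
by move: H; rewrite -(EFin_Rintegral _ (bsq theta)).
Qed.

(** For a fixed sample both sides are sequentially continuous in the parameters. The extension
    involves no further event, so it is valid at a minimizer that depends on [S]. *)
Lemma deviation_closure (S : n.-tuple (d.-tuple R)) (k : R) :
  (forall j, let theta : params m := rational_params j in
    smooth_risk A b c f theta <= sample_risk A b c f S theta
      + k * (2^-1 * (path_norm theta + 1) ^+ 2)) ->
  forall theta, smooth_risk A b c f theta
     <= sample_risk A b c f S theta + k * (2^-1 * (path_norm theta + 1) ^+ 2).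
Proof.
move=> H theta; have [j [ca cw]] := rational_params_dense theta.
apply: (ler_cvg_to (smooth_risk_cvg ca cw)); last by apply: nearW => i; exact: (H (j i)).
apply: cvgD.
  apply: cvgM; first exact: cvg_cst.
  by apply: cvg_sumr => t; apply: cvg_exprn; exact: cvg_residual.
apply: cvgM; first exact: cvg_cst.
apply: cvgM; first exact: cvg_cst.
by apply: cvg_exprn; apply: cvgD; [exact: cvg_path_norm|exact: cvg_cst].
Qed.

End generalization.

(* With [l1 >= 3/5], the penalty [Q ^ 2 * l1] absorbs the deviation [(Q + 1) ^ 2 / 2]
   of the minimizer up to the constant 3. *)
Lemma penalty_balance {R : realFieldType} (x Q q B l1 l2 l3 r s r1 s1 K : R) :
  0 <= x -> 0 <= q <= 2 * B -> 3 / 5 <= l1 -> 0 <= l2 <= l3 ->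
  r <= s + x * (2^-1 * (Q + 1) ^+ 2) ->
  s + x * (Q ^+ 2 * l1) <= s1 + x * (q ^+ 2 * l2) ->
  s1 <= r1 + x * (2^-1 * (q + 1) ^+ 2) -> r1 <= K ->
  r <= K + x * (4 * (B ^+ 2 + 1) * (l3 + 1)).
Proof.
move=> x0 /andP[q0 qB] l1g /andP[l20 l23] h1 h2 h3 h4.
have k1 : 2^-1 * (Q + 1) ^+ 2 <= Q ^+ 2 * l1 + 3.
  have : Q ^+ 2 * (3 / 5) <= Q ^+ 2 * l1 by rewrite ler_wpM2l ?sqr_ge0.
  (* With l1 = 3/5 the slack is exactly (Q - 5)^2 / 10, which is where the constant 3 comes from. *)
  by have := sqr_ge0 (Q - 5); rewrite !sqrrD; lra.
have k2 : q ^+ 2 * l2 <= 4 * B ^+ 2 * l3.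
  rewrite (_ : 4 * B ^+ 2 = (2 * B) ^+ 2); last by ring.
  by rewrite ler_pM ?sqr_ge0// lerXn2r ?nnegrE//; lra.
have k3 : 2^-1 * (q + 1) ^+ 2 <= 4 * B ^+ 2 + 1.
  have : (q + 1) ^+ 2 <= (2 * B + 1) ^+ 2 by rewrite lerXn2r ?nnegrE//; lra.
  by have := sqr_ge0 (2 * B - 1); rewrite !sqrrD; lra.
have key : x * (2^-1 * (Q + 1) ^+ 2 - Q ^+ 2 * l1 + q ^+ 2 * l2 + 2^-1 * (q + 1) ^+ 2)
    <= x * (4 * (B ^+ 2 + 1) * (l3 + 1)).
  rewrite ler_wpM2l//; have l30 : 0 <= l3 by exact: le_trans l23.
  by lra.
by lra.
Qed.


Theorem theorem3p3 (R : realType) (d m n : nat)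
    (hd : (0 < d)%N) (hm : (0 < m)%N) (hn : (0 < n)%N)
    (M : R) (hM : 1 <= M)
    (A : 'rV[R]_d -> 'M[R]_d) (b : 'rV[R]_d -> 'rV[R]_d) (c : 'rV[R]_d -> R)
    (mA : forall i j,
       measurable_fun (pt @^-1` cube) (fun t : d.-tuple R => A (pt t) i j))
    (mb : forall i,
       measurable_fun (pt @^-1` cube) (fun t : d.-tuple R => b (pt t) 0 i))
    (mc : measurable_fun (pt @^-1` cube) (fun t : d.-tuple R => c (pt t)))
    (A_sym : forall x, cube x -> forall i j, A x i j = A x j i)
    (A_bnd : forall x, cube x -> forall i j, `|A x i j| <= M)
    (b_bnd : forall x, cube x -> forall i, `|b x 0 i| <= M)
    (c_bnd : forall x, cube x -> `|c x| <= M)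
    (f : 'rV[R]_d -> R)
    (f_bnd : forall x, cube x -> `|f x| <= 1)
    (f_barron : (barron_norm A b c f < +oo)%E)
    (delta : R) (hdelta : 0 < delta < 1)
    (lambda : R)
    (hlambda : 4 * M ^+ 2 *
       (2 + 14 * d%:R ^+ 2 * Num.sqrt (2 * ln (2 * d%:R))
          + Num.sqrt (2 * ln (2 / (3 * delta)))) <= lambda) :
  let B := fine (barron_norm A b c f) in
  exists E : set (n.-tuple (d.-tuple R)),
    [/\ measurable E,
        ((1 - delta)%:E <= iid uniform_cube n E)%E &
        forall S, E S -> forall theta : params m,
          is_minimizer A b c f lambda S theta ->
          (population_risk A b c f theta <=
             (6 * M ^+ 2 * B ^+ 2 / m%:R
              + (B ^+ 2 + 1) / Num.sqrt n%:R * (4 * lambda + 16 * M ^+ 2)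
                * (ln (pi * (2 * B + 1))
                   + 14 * d%:R ^+ 2 * Num.sqrt (ln (2 * d%:R))
                   + Num.sqrt (ln (2 / (3 * delta)))))%:E)%E].
Proof.
have M0 : 0 <= M by exact: le_trans hM.
have mf := measurable_barron mA mb mc f_barron.
have [theta1 [risk1 norm1]] := barron_approximation hM mA mb mc A_bnd b_bnd c_bnd f_bnd hm f_barron.
move=> B; rewrite -/B in risk1 norm1.
have B0 : 0 <= B by exact: fine_barron_norm_ge0.
have [E [mE PE HE]] := network_deviation hM mA mb mc mf A_bnd b_bnd c_bnd f_bnd hd hm hn
  hdelta hlambda (fun j => rational_params j) theta1.
exists E; split=> // S ES theta min_theta.
have [cS up low] := HE S ES.
apply: le_trans (population_risk_le hM mA mb mc A_bnd b_bnd c_bnd f_bnd mf theta) _.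
rewrite lee_fin.
have upper := deviation_closure hM mA mb mc A_bnd b_bnd c_bnd f_bnd mf up theta.
have := min_theta theta1; rewrite /objective !empirical_risk_clip// => opt.
have lambda0 : 0 <= lambda.
  apply: (le_trans _ hlambda); apply: mulr_ge0; first by rewrite mulr_ge0 ?sqr_ge0.
  by rewrite addr_ge0 ?sqrtr_ge0// addr_ge0// mulr_ge0 ?sqrtr_ge0.
have sn0 : 0 < Num.sqrt n%:R :> R by rewrite sqrtr_gt0 ltr0n.
set x := lambda / Num.sqrt n%:R in upper opt low.
have x0 : 0 <= x by rewrite divr_ge0// ltW.
have Q0 := path_norm_ge0 theta; have q0 := path_norm_ge0 theta1.
have pi2 := @pi_ge2 R.
(* Since pi >= 2, the logarithm in the penalty is at least ln 2 even at path norm zero. *)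
have ln_pi (y : R) : 0 <= y -> 3 / 5 <= ln (pi * (y + 1)).
  move=> y0; apply: le_trans ln2_ge _; rewrite ler_ln ?posrE//; last by nra.
  by nra.
rewrite -(mulrA x (path_norm theta ^+ 2)) -(mulrA x (path_norm theta1 ^+ 2)) in opt.
have l23 : 0 <= ln (pi * (path_norm theta1 + 1)) <= ln (pi * (2 * B + 1)).
  apply/andP; split; first by have := ln_pi _ q0; lra.
  by rewrite ler_ln ?posrE ?mulr_gt0 ?pi_gt0// ?ler_pM2l ?pi_gt0//; lra.
have qB : 0 <= path_norm theta1 <= 2 * B by rewrite q0.
apply: le_trans (penalty_balance x0 qB (ln_pi _ Q0) l23 upper opt low risk1) _.
rewrite lerD2l; set l := ln (pi * (2 * B + 1)).
have l0 : 0 <= l by have /andP[h1 h2] := l23; exact: le_trans h1 h2.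
set D := 14 * _ * _; set T := Num.sqrt (ln (2 / (3 * delta))).
(* Lets the dimension term absorb the 1 in the factor [l + 1] left by [penalty_balance]. *)
have D1 : 1 <= D.
  have d1 : (1 : R) <= d%:R by rewrite ler1n.
  have d2 : (1 : R) <= d%:R ^+ 2 by rewrite expr2 mulr_ege1.
  have s1 : 3 / 5 <= Num.sqrt (ln (2 * d%:R)) :> R.
    rewrite -[leLHS]ger0_norm ?divr_ge0// -sqrtr_sqr ler_wsqrtr//.
    apply: (@le_trans _ _ (ln 2)); first by apply: le_trans ln2_ge; lra.
    by rewrite ler_ln ?posrE; lra.
  by rewrite /D; nra.
have T0 : 0 <= T by exact: sqrtr_ge0.
have -> : x * (4 * (B ^+ 2 + 1) * (l + 1)) =
    (B ^+ 2 + 1) / Num.sqrt n%:R * (4 * lambda * (l + 1)) by rewrite /x; ring.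
rewrite -[leRHS]mulrA ler_wpM2l//.
  by rewrite divr_ge0 ?addr_ge0 ?sqr_ge0// ltW.
rewrite ler_pM// ?mulr_ge0 ?addr_ge0//; last by lra.
by rewrite lerDl mulr_ge0 ?sqr_ge0.
Qed.
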